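(* Let $p$ and $q$ be distinct primes. Then the monic divisors in $\mathbb{Z}[x]$ of $x^{p^2q}-1$ are coefficient convex, with the exception, in case $q=2$, of $(x+1)\Phi_p(x)\Phi_{2p^2}(x)$, whose coefficient set is $\mathcal{C}((x+1)\Phi_p\Phi_{2p^2})=\{-2,0,1,2\}$. If $\min(p,q)>3$, then all monic divisors in $\mathbb{Z}[x]$ of $x^{p^2q}-1$, except $x-1$, are strongly coefficient convex.
   Context: $\Phi_n(x)$ denotes the $n$th cyclotomic polynomial. For a nonzero polynomial $f(x)=\sum_{j} c_jx^j\in\mathbb{Z}[x]$ put $\mathcal{C}(f)=\{c_j : 0\le j\le \deg f\}$ (its coefficient set) and $\mathcal{C}_0(f)=\mathcal{C}(f)\cup\{0\}$. The polynomial $f$ is called coefficient convex if there are integers $a\le b$ such that $\mathcal{C}_0(f)=\{a,a+1,\ldots,b\}$, and strongly coefficient convex if there are integers $a\le b$ such that $\mathcal{C}(f)=\{a,a+1,\ldots,b\}$. *)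

(* Defs.v *)
From mathcomp Require Import all_boot all_order all_algebra all_field.

Set Implicit Arguments.
Unset Strict Implicit.
Unset Printing Implicit Defensive.

Import Order.TTheory GRing.Theory Num.Theory.

Local Open Scope ring_scope.

(* Divisibility is taken in Z[x] itself: over int the library's [%|] on
   polynomials is pseudo-divisibility, i.e. divisibility over the rationals. *)
Definition monic_divisor (f g : {poly int}) : Prop :=
  f \is monic /\ exists h : {poly int}, g = h * f.

(* The underlying sequence of a nonzero f lists exactly its coefficients of
   index 0 to deg f, so its members form C(f), which contains 0 only if one of
   these coefficients vanishes. *)
Definition coef_set (f : {poly int}) : pred int :=
  [pred c | c \in (f : seq int)].

Definition coef_set0 (f : {poly int}) : pred int :=
  [pred c | (c \in coef_set f) || (c == 0)].

Definition int_interval (a b : int) : pred int := [pred c | a <= c <= b].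

Definition coef_convex (f : {poly int}) : Prop :=
  exists a b : int, a <= b /\ coef_set0 f =i int_interval a b.

Definition strongly_coef_convex (f : {poly int}) : Prop :=
  exists a b : int, a <= b /\ coef_set f =i int_interval a b.

(* Main.v *)
(* Write A, P, Q, R, S, T for the cyclotomic polynomials of index 1, p, q, pq, p^2, p^2 q; the monic
   divisors of X^(p^2 q) - 1 are the 64 products of distinct factors among these. If (X^m - 1) f
   has coefficients in {-1, 0, 1} for some m > 0, then along each residue class mod m the
   coefficients of f start and end at 0 and move by steps of at most 1, so f is coefficient convex;
   for m = 1 it is even strongly so. A multiple of A is antisymmetric, so it is also convex as soon
   as its coefficients are at most 2 in absolute value. These two remarks cover all products but
   PQT and ARS.

   For ARS the coefficients along the class of 1 mod p are 2 t(k) - t(k - e) - t(k - (q - e)) with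
   t(k) = min(max(k, 0), p) and q q* = 1 + p e. This sequence jumps by 2 both on its way up and on
   its way down, but it skips values of opposite parities when q is odd, and it reaches the largest
   absolute value of all coefficients.

   For PQT, let W be the power series (1 + X + ... + X^(p-1))^2 H(X^p), where H is the indicator
   series of the numerical semigroup generated by p and q. The n-th coefficient of PQT is
   W_n - W_(n-q). Since W takes values in [0, p], is 1-Lipschitz and satisfies
   W_n >= W_(n - p^2 i), the coefficients lie between - min(p, |q - p^2 i|) and min(p, q) for every
   i. If p, q > 2 then, for the i nearest to q / p^2, all integers between these bounds are found at
   explicit places near n = 0 and n = q; if p = 2 the lower bound is - 1.

   If p, q > 3 the missing ingredient is a vanishing coefficient. Modulo X^4 the factors P, Q, R
   are - A^-1, - A^-1, - A, and S, T are 1, so that a product congruent to a power A^m, m >= 0, has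
   no term in X^3; the other products are either of the type (X - 1) f flat or PT, PQT, APQT. *)

Require Import Defs.
From mathcomp Require Import all_boot all_order all_algebra all_field.
From mathcomp Require Import zify ring.

Import Order.TTheory GRing.Theory Num.Theory.
Local Open Scope ring_scope.

(** * Coefficient convexity from bounded steps *)

(** Discrete intermediate value theorem, by induction on the length: a value [c] other than the last
    one stays between [u a] and the last but one, because the final step is at most 1. *)
Lemma stepwise_ivt (u : nat -> int) (a b : nat) (c : int) :
  (a <= b)%N ->
  (forall i, (a <= i < b)%N -> -1 <= u i.+1 - u i <= 1) ->
  (u a <= c <= u b) || (u b <= c <= u a) ->
  exists2 i, (a <= i <= b)%N & u i = c.
Proof.
move=> /subnKC <-; elim: (b - a)%N => [|k IH] step.
  by rewrite addn0 orbb => c_eq; exists a; [lia | lia].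
have [/eqP <- _|ne] := boolP (u (a + k.+1)%N == c).
  by exists (a + k.+1)%N; lia.
move=> cab; have := step (a + k)%N; rewrite -addnS => /(_ _)/andP[|s1 s2]; first lia.
case: IH => [i lti||i lei <-]; [by apply: step; lia | lia | by exists i; lia].
Qed.

Definition flat (f : {poly int}) := forall i, -1 <= f`_i <= 1.

Definition zero_one (f : {poly int}) := forall i, 0 <= f`_i <= 1.

Lemma zero_one_flat f : zero_one f -> flat f.
Proof. by move=> f01 i; have := f01 i; lia. Qed.

Lemma in_coef_set (f : {poly int}) c :
  (c \in coef_set f) <-> exists2 i, (i < size f)%N & f`_i = c.
Proof.
rewrite inE; split=> [/(nthP 0) [i lti <-]|[i lti <-]]; first by exists i.
exact: mem_nth.
Qed.

Lemma in_coef_set0 (f : {poly int}) c :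
  (c \in coef_set0 f) <-> exists i, f`_i = c.
Proof.
rewrite inE; split=> [/orP[/in_coef_set [i _ <-]|/eqP ->]|[i <-]]; first by exists i.
  by exists (size f); rewrite nth_default.
have [lti|lei] := ltnP i (size f); last by rewrite nth_default ?eqxx ?orbT.
by apply/orP; left; apply/in_coef_set; exists i.
Qed.

Lemma seq_max (x : int) (s : seq int) :
  exists2 b, b \in x :: s & forall y, y \in x :: s -> y <= b.
Proof.
elim: s x => [|z s IH] x; first by exists x; rewrite ?inE // => y; rewrite inE => /eqP ->.
have [b bs bmax] := IH z; have [lexb|ltbx] := leP x b.
  by exists b => [|y]; rewrite in_cons ?bs ?orbT // => /predU1P[->|/bmax].
exists x => [|y]; rewrite in_cons ?eqxx // => /predU1P[->//|/bmax]; lia.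
Qed.

Lemma seq_min (x : int) (s : seq int) :
  exists2 b, b \in x :: s & forall y, y \in x :: s -> b <= y.
Proof.
have [b] := seq_max (- x) [seq - y | y <- s].
rewrite -(map_cons (fun y : int => - y)) => /mapP[c cs ->] cmax; exists c => // y ys.
by rewrite -lerN2; apply: cmax; rewrite map_f.
Qed.

Lemma interval_of_between (s : seq int) :
  s != [::] -> (forall x y c, x \in s -> y \in s -> x <= c <= y -> c \in s) ->
  exists a b, a <= b /\ s =i int_interval a b.
Proof.
case: s => // x s _ between.
have [b bs bmax] := seq_max x s; have [a as_ amin] := seq_min x s.
exists a, b; split=> [|c]; first exact: bmax.
rewrite !inE; apply/idP/idP => [cs|]; last by rewrite -in_cons; apply: between.
by rewrite amin ?bmax.
Qed.

(** An integer between two coefficients lies between 0 and one of them, so it suffices to fill the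
    gaps towards 0. Indices beyond the degree are allowed and supply the 0 of [coef_set0]. *)
Lemma coef_convexP (f : {poly int}) :
  (forall i c, (0 <= c <= f`_i) || (f`_i <= c <= 0) -> exists j, f`_j = c) ->
  coef_convex f.
Proof.
move=> star; have set0E c : (c \in coef_set0 f) = (c \in 0 :: (f : seq int)).
  by rewrite !inE orbC.
have [x y c| a [b [leab iab]]] := interval_of_between (0 :: (f : seq int)) isT.
  rewrite -!set0E => /in_coef_set0[i <-] /in_coef_set0[j <-] /andP[lei lej].
  apply/in_coef_set0; have [c0|c0] := leP 0 c.
    by apply: (star j); rewrite c0 lej.
  by apply: (star i); rewrite lei (ltW c0) orbT.
by exists a, b; split=> // c; rewrite set0E iab.
Qed.

Lemma strongly_coef_convexP (f : {poly int}) :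
  f != 0 ->
  (forall i j c, (i < size f)%N -> (j < size f)%N -> f`_i <= c <= f`_j ->
     c \in coef_set f) ->
  strongly_coef_convex f.
Proof.
move=> f0 between; have [||a [b [leab iab]]] := interval_of_between (f : seq int).
- by rewrite -size_eq0 size_poly_eq0.
- by move=> x y c /(nthP 0)[i lti <-] /(nthP 0)[j ltj <-] /(between _ _ _ lti ltj).
by exists a, b.
Qed.

Lemma convex_strongly_convex (f : {poly int}) i :
  coef_convex f -> (i < size f)%N -> f`_i = 0 -> strongly_coef_convex f.
Proof.
move=> [a [b [leab iab]]] lti fi0; exists a, b; split=> // c.
rewrite -iab.
suff f0 : 0 \in coef_set f.
  by rewrite [RHS]inE; case: eqP => [->|_]; rewrite ?orbF ?f0.
by apply/in_coef_set; exists i.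
Qed.

Lemma coefXnsub1M m (f : {poly int}) n :
  (('X^m - 1) * f)`_n = (if (n < m)%N then 0 else f`_(n - m)) - f`_n.
Proof. by rewrite mulrBl mul1r coefB coefXnM. Qed.

Lemma zero_one_flat_step m (f : {poly int}) :
  zero_one f -> flat (('X^m - 1) * f).
Proof.
by move=> f01 n; rewrite coefXnsub1M; have := f01 n; have := f01 (n - m)%N; case: ifP; lia.
Qed.

Lemma flat_step_convex m (f : {poly int}) :
  (0 < m)%N -> flat (('X^m - 1) * f) -> coef_convex f.
Proof.
move=> m0 fl; apply: coef_convexP => i c ic.
(* Within the residue class of i mod m, read upwards until the coefficients vanish. *)
pose u k := f`_(i + m * k).
have [||k _ <-] := stepwise_ivt u 0 (size f) c (leq0n _); last by exists (i + m * k)%N.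
  move=> k _; have := fl (i + m * k.+1)%N; rewrite coefXnsub1M.
  rewrite (_ : i + m * k.+1 = i + m * k + m)%N ?mulnS; last lia.
  rewrite ltnNge leq_addl addnK -/(u k) (_ : i + m * k + m = i + m * k.+1)%N ?mulnS; last lia.
  by rewrite -mulnS -/(u k.+1) /=; lia.
have -> : u (size f) = 0 by rewrite /u nth_default // (leq_trans (leq_pmull _ m0)) ?leq_addl.
by rewrite /u muln0 addn0 orbC.
Qed.

(** For m = 1 a path joins any two coefficients without leaving the indices below [size f], so every
    value met belongs to [coef_set f]. *)
Lemma flat_step_strongly_convex (f : {poly int}) :
  f != 0 -> flat (('X - 1) * f) -> strongly_coef_convex f.
Proof.
move=> f0 fl; apply: strongly_coef_convexP => // i j c lti ltj ijc.
have step k : -1 <= f`_k.+1 - f`_k <= 1.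
  by have := fl k.+1; rewrite -['X]expr1 coefXnsub1M /= subn1 /=; lia.
apply/in_coef_set; have [leij|/ltnW leji] := leqP i j.
  have [//|//||k lek <-] := stepwise_ivt (nth 0 f) i j c; last by exists k; lia.
  by rewrite ijc.
have [//|//||k lek <-] := stepwise_ivt (nth 0 f) j i c; last by exists k; lia.
by rewrite ijc orbT.
Qed.

Lemma monic_coef1 (f : {poly int}) : f \is monic -> exists2 i, (i < size f)%N & f`_i = 1.
Proof.
move=> fm; exists (size f).-1; last exact: (monicP fm).
by rewrite prednK // size_poly_gt0 monic_neq0.
Qed.

Lemma flat_convex (f : {poly int}) : flat f -> coef_convex f.
Proof.
move=> fl; apply: coef_convexP => i c ic; have := fl i => fli.
have /orP[/eqP ->|/eqP ->] : (c == f`_i) || (c == 0) by lia.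
  by exists i.
by exists (size f); rewrite nth_default.
Qed.

(** * Geometric sums, flatness and reciprocal polynomials *)

(** The quotient of X^(m k) - 1 by X^m - 1 for m > 0. Written as a composition, it makes the
    substitution of X^n a mere change of [m]. *)
Definition geom (m k : nat) : {poly int} := (\poly_(i < k) 1) \Po 'X^m.

Lemma coef_geom m k n : (0 < m)%N ->
  (geom m k)`_n = ((m %| n)%N && (n < k * m)%N)%:R.
Proof.
move=> m0; rewrite /geom coef_comp_poly_Xn // coef_poly; case: dvdnP => [[c ->]|] //=.
by rewrite mulnK // ltn_pmul2r //=; case: (_ < _)%N.
Qed.

Lemma zero_one_geom m k : (0 < m)%N -> zero_one (geom m k).
Proof. by move=> m0 n; rewrite coef_geom //; case: (_ && (_ < _)%N). Qed.

Lemma geom1E k : geom 1 k = \sum_(i < k) 'X^i.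
Proof.
rewrite /geom expr1 comp_polyXr poly_def; apply: eq_bigr => i _.
by rewrite scale1r.
Qed.

Lemma geom_comp m n k : geom m k \Po 'X^n = geom (m * n) k.
Proof. by rewrite /geom -comp_polyA comp_Xn_poly -exprM mulnC. Qed.

Lemma geomP m k : ('X^m - 1) * geom m k = 'X^(m * k) - 1.
Proof.
have -> : 'X^m - 1 = ('X - 1) \Po 'X^m :> {poly int} by rewrite comp_polyB comp_polyX comp_polyC.
rewrite -[m in geom m]mul1n -geom_comp -comp_polyM geom1E -subrX1.
by rewrite comp_polyB comp_Xn_poly comp_polyC exprM.
Qed.

Lemma Xnsub1_neq0 n : (0 < n)%N -> 'X^n - 1 != 0 :> {poly int}.
Proof. by move=> n0; rewrite monic_neq0 // monicXnsubC. Qed.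

(** In the convolution at [n], only the exponent i < N with N | n - i counts, which is the remainder
    of [n]. *)
Lemma coef_mul_comp_Xn (g h : {poly int}) N n : (0 < N)%N -> (size g <= N)%N ->
  (g * (h \Po 'X^N))`_n = g`_(n %% N) * h`_(n %/ N).
Proof.
move=> N0 szg; have ltnN := ltn_pmod n N0; have lenN := leq_mod n N.
rewrite coefM (bigD1 (Ordinal (lenN : (_ < n.+1)%N))) //= big1 ?addr0.
  rewrite coef_comp_poly_Xn // (_ : n - n %% N = n %/ N * N)%N ?dvdn_mull ?mulnK //.
  by rewrite {1}(divn_eq n N) addnK.
move=> [i lti] /eqP ne; have [ltiN|leNi] := ltnP i N; last first.
  by rewrite /= nth_default ?mul0r // (leq_trans szg).
rewrite /= coef_comp_poly_Xn //; case: dvdnP; last by rewrite mulr0.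
move=> [c nic]; case: ne; apply/val_inj => /=.
by rewrite -(subnK (lti : i <= n)%N) nic modnMDl modn_small.
Qed.

Lemma flat_spread (g h : {poly int}) N : (0 < N)%N -> (size g <= N)%N ->
  flat g -> flat h -> flat (g * (h \Po 'X^N)).
Proof.
move=> N0 szg gf hf n; rewrite coef_mul_comp_Xn //.
by have := gf (n %% N)%N; have := hf (n %/ N)%N; nia.
Qed.

Lemma flat_comp_Xn (h : {poly int}) N : (0 < N)%N -> flat h -> flat (h \Po 'X^N).
Proof.
move=> N0 hf; rewrite -[_ \Po _]mul1r; apply: flat_spread; rewrite ?size_poly1 //.
by move=> i; rewrite coef1; case: eqP.
Qed.

Lemma zero_one_spread (g h : {poly int}) N : (0 < N)%N -> (size g <= N)%N ->
  zero_one g -> zero_one h -> zero_one (g * (h \Po 'X^N)).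
Proof.
move=> N0 szg gf hf n; rewrite coef_mul_comp_Xn //.
by have := gf (n %% N)%N; have := hf (n %/ N)%N; nia.
Qed.

Lemma sum_unique_zero_one (I : finType) (F : I -> int) :
  (forall i, 0 <= F i <= 1) ->
  (forall i j, F i != 0 -> F j != 0 -> i = j) -> 0 <= \sum_i F i <= 1.
Proof.
move=> F01 uni; have [/existsP[i Fi]|] := boolP [exists i, F i != 0].
  rewrite (bigD1 i) //= big1 ?addr0 // => j; apply: contra_neq_eq => Fj.
  exact: uni.
rewrite negb_exists => /forallP F0; rewrite big1 // => i _.
by apply/eqP; have := F0 i; rewrite negbK.
Qed.

(** An index has at most one expression a i + b j with i < b, because [a] is invertible modulo
    [b]. *)
Lemma zero_one_geom_coprime a b L : (0 < a)%N -> (0 < b)%N -> coprime a b ->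
  zero_one (geom a b * geom b L).
Proof.
move=> a0 b0 cab n; rewrite coefM; apply: sum_unique_zero_one => [i|[i lti] [j ltj]].
  by rewrite !coef_geom //; case: (_ && (_ < _)%N); case: (_ && (_ < _)%N).
rewrite !coef_geom //= => nzi nzj; apply/val_inj => /=; move: nzi nzj lti ltj.
case: (boolP (a %| i)%N) => [/dvdnP[i' ->]|_]; last by rewrite mul0r eqxx.
case: (boolP (a %| j)%N) => [/dvdnP[j' ->]|_]; last by rewrite mul0r eqxx.
rewrite !(mulnC _ a) !ltn_pmul2l //=.
case: (ltnP i' b) => [lti'|_]; last by rewrite mul0r eqxx.
case: (ltnP j' b) => [ltj'|_]; last by rewrite mul0r eqxx.
case: (boolP (b %| n - a * i')%N) => [dvi|_]; last by rewrite mulr0 eqxx.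
case: (boolP (b %| n - a * j')%N) => [dvj|_]; last by rewrite mulr0 eqxx.
move=> _ _ /[!ltnS] lti ltj; congr (_ * _)%N.
suff : i' = j' %[mod b] by rewrite !modn_small.
apply/eqP; wlog le : i' j' lti ltj dvi dvj lti' ltj' / (j' <= i')%N.
  by move=> W; case/orP: (leq_total j' i') => /W; [|rewrite eq_sym]; apply.
rewrite eqn_mod_dvd // -(Gauss_dvdr _ (_ : coprime b a)) 1?coprime_sym // mulnBr.
have -> : (a * i' - a * j' = (n - a * j') - (n - a * i'))%N by lia.
exact: dvdn_sub.
Qed.

(** Below [N], multiplication by X^N - 1 only changes signs. *)
Lemma flat_of_flat_step N (f : {poly int}) :
  (size f <= N)%N -> flat (('X^N - 1) * f) -> flat f.
Proof.
move=> szf fl i; have [lti|lei] := ltnP i N; last by rewrite nth_default ?(leq_trans szf).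
by have := fl i; rewrite coefXnsub1M lti; lia.
Qed.

(* Multiplying the hypothesis by [geom b L] turns the factor ['X^b - 1] of [f] into
   ['X^(b * L) - 1], which leaves the coefficients of [f] visible, up to sign. *)
Lemma flat_coprime_quotient m a b (f : {poly int}) :
  (0 < a)%N -> (0 < b)%N -> coprime a b ->
  f * ('X^a - 1) * ('X^b - 1) = ('X^m - 1) * ('X^(a * b) - 1) -> flat f.
Proof.
move=> a0 b0 cab fE; apply: (@flat_of_flat_step (b * size f)); first by rewrite leq_pmull.
suff -> : ('X^(b * size f) - 1) * f = ('X^m - 1) * (geom a b * geom b (size f)).
  exact/zero_one_flat_step/zero_one_geom_coprime.
have fE' : f * ('X^b - 1) = ('X^m - 1) * geom a b.
  by apply: (mulfI (Xnsub1_neq0 _ a0)); rewrite !mulrA (mulrC _ f) fE -(geomP a b); ring.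
by rewrite -(geomP b) mulrA -fE'; ring.
Qed.

(** X^d f(1/X) when deg f <= d. Keeping [d] separate from the degree makes the operation linear, and
    products add up the bounds. *)
Definition rev_poly d (f : {poly int}) : {poly int} := \poly_(i < d.+1) f`_(d - i).

Lemma rev_polyE d (f : {poly int}) : rev_poly d f = \sum_(i < d.+1) f`_i *: 'X^(d - i).
Proof.
rewrite /rev_poly poly_def (reindex_inj rev_ord_inj) /=; apply: eq_bigr => i _.
by rewrite subSS subKn // -ltnS.
Qed.

Lemma rev_polyM d e (f g : {poly int}) :
  (size f <= d.+1)%N -> (size g <= e.+1)%N ->
  rev_poly (d + e) (f * g) = rev_poly d f * rev_poly e g.
Proof.
move=> szf szg; have revD N (I : finType) (F : I -> {poly int}) :
    rev_poly N (\sum_i F i) = \sum_i rev_poly N (F i).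
  apply/polyP => i; rewrite coef_poly !coef_sum; case: ltnP => h; last first.
    by rewrite big1 // => j _; rewrite coef_poly ltnNge h.
  by apply: eq_bigr => j _; rewrite coef_poly h.
have revXn N k c : (k <= N)%N -> rev_poly N (c *: 'X^k) = c *: 'X^(N - k).
  move=> lek; apply/polyP => i; rewrite coef_poly !coefZ !coefXn ltnS.
  by case: leqP => leiN; lia.
have polyE N (h : {poly int}) : (size h <= N.+1)%N -> h = \sum_(i < N.+1) h`_i *: 'X^i.
  move=> szh; rewrite -poly_def; apply/polyP => i; rewrite coef_poly.
  by case: ltnP => // lei; rewrite nth_default ?(leq_trans szh).
rewrite !rev_polyE [in LHS](polyE d f szf) [in LHS](polyE e g szg) -rev_polyE.
rewrite !big_distrl revD; apply: eq_bigr => i _ /=.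
rewrite !big_distrr revD; apply: eq_bigr => j _ /=.
rewrite -!scalerAl -!scalerAr !scalerA -!exprD revXn ?leq_add // -1?ltnS //.
by congr (_ *: 'X^_); have := ltn_ord i; have := ltn_ord j; lia.
Qed.

Definition self_reciprocal (s : int) (f : {poly int}) :=
  rev_poly (size f).-1 f = s *: f.

Lemma rev_polyM_size (f g : {poly int}) : f != 0 -> g != 0 ->
  rev_poly (size (f * g)).-1 (f * g) = rev_poly (size f).-1 f * rev_poly (size g).-1 g.
Proof.
move=> f0 g0; rewrite size_mul // -rev_polyM ?leqSpred //; congr (rev_poly _ _).
by move: f0 g0; rewrite -!size_poly_gt0; case: (size f) => // m; case: (size g) => // n; lia.
Qed.

Lemma self_reciprocalM s t (f g : {poly int}) : f != 0 -> g != 0 ->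
  self_reciprocal s f -> self_reciprocal t g -> self_reciprocal (s * t) (f * g).
Proof.
move=> f0 g0 rf rg.
by rewrite /self_reciprocal rev_polyM_size // rf rg -scalerAl -scalerAr scalerA.
Qed.

Lemma self_reciprocal_divl s t (f g : {poly int}) : s * s = 1 -> f != 0 -> g != 0 ->
  self_reciprocal s f -> self_reciprocal t (f * g) -> self_reciprocal (s * t) g.
Proof.
move=> ss f0 g0 rf; rewrite /self_reciprocal rev_polyM_size // rf => rfg.
apply: (mulfI f0); rewrite -scalerAr -scalerA -rfg -scalerAl scalerA ss.
by rewrite scale1r.
Qed.

Lemma self_reciprocal_Xnsub1 n : (0 < n)%N -> self_reciprocal (- 1) ('X^n - 1).
Proof.
move=> n0; rewrite /self_reciprocal size_XnsubC //.
apply/polyP => i; rewrite coef_poly coefZ !coefB !coefXn !coef1 ltnS /=.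
by case: leqP => lein; lia.
Qed.

Lemma anti_reciprocal_coefN (f : {poly int}) i :
  self_reciprocal (- 1) f -> exists j, f`_j = - f`_i.
Proof.
move=> /polyP rf; have [ltd|led] := ltnP i (size f); last first.
  by exists i; rewrite nth_default ?oppr0.
exists ((size f).-1 - i)%N; have := rf i.
by rewrite coef_poly prednK ?ltd ?coefZ ?mulN1r //; lia.
Qed.

(** The leading coefficient 1 and, by antisymmetry, -1 occur; between 0 and a coefficient of
    absolute value at most 2 nothing else can be missing. *)
Lemma anti_reciprocal_convex (f : {poly int}) :
  self_reciprocal (- 1) f -> f \is monic -> (forall i, -2 <= f`_i <= 2) -> coef_convex f.
Proof.
move=> rf fm f2; apply: coef_convexP => i c; have [j _ fj] := monic_coef1 f fm.
have [k fk] := anti_reciprocal_coefN f j rf; rewrite fj in fk.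
have := f2 i => fi ci; have : [|| c == f`_i, c == 0, c == 1 | c == - 1] by lia.
case/or4P=> /eqP ->; [by exists i | | by exists j | by exists k].
by exists (size f); rewrite nth_default.
Qed.

(** * Factorization of the monic divisors *)

(** Division by the monic ['Phi_d] stays in Z[x]; the remainder vanishes at [z] and has smaller
    degree than ['Phi_d], the minimal polynomial of [z], so it is 0. *)
Lemma Cyclotomic_dvd d (z : algC) (r : {poly int}) :
  d.-primitive_root z -> root (map_poly intr r) z -> exists r', r = r' * 'Phi_d.
Proof.
move=> prim_z rz0; have monP := Cyclotomic_monic d.
have r_eq := Pdiv.RingMonic.rdivp_eq monP r.
set r' := Pdiv.Ring.rdivp _ _ in r_eq; set r0 := Pdiv.Ring.rmodp _ _ in r_eq.
exists r'; rewrite r_eq (_ : r0 = 0) ?addr0 //.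
have szr0 : (size r0 < size 'Phi_d)%N by rewrite Pdiv.Ring.ltn_rmodpN0 ?monic_neq0.
have [pz [pzE _] pzP] := minCpolyP z; have mz := minCpoly_cyclotomic prim_z.
have Phiz : map_poly intr 'Phi_d = minCpoly z by rewrite mz; exact: Cintr_Cyclotomic.
have QC (s : {poly int}) :
    map_poly ratr (map_poly (intr : int -> rat) s) = map_poly (intr : int -> algC) s.
  by rewrite -map_poly_comp; apply: eq_map_poly => x /=; rewrite ratr_int.
have Zinj : injective (intr : int -> rat) by exact: intr_inj.
have szQ (s : {poly int}) : size (map_poly (intr : int -> rat) s) = size s.
  exact: size_map_inj_poly.
have r0z : root (map_poly intr r0) z.
  move: rz0; rewrite r_eq rmorphD rmorphM /= Phiz /root hornerD hornerM.
  by rewrite (rootP (root_minCpoly z)) mulr0 add0r.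
have : (pz %| map_poly (intr : int -> rat) r0)%R by rewrite -pzP QC.
have szp : size pz = size 'Phi_d.
  by rewrite -(size_map_poly (ratr : {rmorphism rat -> algC})) -pzE -Phiz -QC size_map_poly szQ.
move=> dv; apply/eqP; rewrite -size_poly_eq0 -szQ size_poly_eq0.
by apply: contraLR dv => nz; rewrite gtNdvdp ?szQ ?szp.
Qed.

(** Induction on [s]: a primitive d-th root of unity is a root of [h] or of [f], and ['Phi_d] is
    cancelled from that factor; it goes into [t] when the factor is [f]. *)
Lemma monic_factor_prod_Cyclotomic (s : seq nat) (f h : {poly int}) :
  all (leq 1) s -> f \is monic -> h * f = \prod_(d <- s) 'Phi_d ->
  exists2 t, subseq t s & f = \prod_(d <- t) 'Phi_d.
Proof.
elim: s f h => [|d s IH] f h.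
  move=> _ fm /eqP; rewrite big_nil => /eqP hf; exists [::]; rewrite ?big_nil //.
  have := size_mul_eq1 h f; rewrite hf size_poly1 eqxx => /esym/andP[_ /size_poly1P[c _ fE]].
  by move: fm; rewrite fE monicE lead_coefC => /eqP ->.
case/andP=> d0 s0 fm; rewrite big_cons => hf; have [z pz] := C_prim_root_exists d0.
have Phi0 : 'Phi_d != 0 by rewrite monic_neq0 ?Cyclotomic_monic.
have : root (map_poly intr (h * f)) z.
  rewrite hf rmorphM rootM /= (Cintr_Cyclotomic pz).
  by rewrite root_cyclotomic ?pz.
rewrite rmorphM rootM => /orP[] /(Cyclotomic_dvd _ _ _ pz)[r' rE].
  have [|t ts ->] := IH f r' s0 fm.
    by apply: (mulfI Phi0); rewrite -hf rE; ring.
  by exists t => //; rewrite (subseq_trans ts) ?subseq_cons.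
have r'm : r' \is monic by move: fm; rewrite rE monicMr ?Cyclotomic_monic.
have [|t ts r'E] := IH r' h s0 r'm.
  by apply: (mulfI Phi0); rewrite -hf rE; ring.
by exists (d :: t); rewrite /= ?eqxx // big_cons rE r'E mulrC.
Qed.

Lemma divisors_pfactor p k : prime p ->
  perm_eq (divisors (p ^ k)) [seq (p ^ i)%N | i <- iota 0 k.+1].
Proof.
move=> pp; apply: uniq_perm; first exact: divisors_uniq.
  by rewrite map_inj_uniq ?iota_uniq // => i j /(expnI (prime_gt1 pp)).
move=> d; rewrite -dvdn_divisors ?expn_gt0 ?prime_gt0 //.
apply/idP/mapP => [/(dvdn_pfactor _ _ pp)[m lem ->]|[m lem ->]].
  by exists m; rewrite // mem_iota ltnS.
by rewrite dvdn_exp2l //; move: lem; rewrite mem_iota ltnS.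
Qed.

Lemma divisors_mul_prime m q : (0 < m)%N -> prime q -> coprime m q ->
  perm_eq (divisors (m * q)) (divisors m ++ [seq (d * q)%N | d <- divisors m]).
Proof.
move=> m0 pq cmq; have q0 := prime_gt0 pq; have q1 := prime_gt1 pq.
have nq d : (d %| m)%N -> ~~ (q %| d)%N.
  by move=> dm; rewrite -prime_coprime // coprime_sym (coprime_dvdl dm).
apply: uniq_perm; first exact: divisors_uniq.
  rewrite cat_uniq divisors_uniq map_inj_uniq ?divisors_uniq ?andbT /=; last first.
    by move=> x y /eqP; rewrite eqn_pmul2r // => /eqP.
  apply/hasPn => _ /mapP[d _ ->]; rewrite -dvdn_divisors //.
  by apply: contraTN (dvdn_mull d (dvdnn q)) => /nq.
move=> d; rewrite mem_cat -!dvdn_divisors ?muln_gt0 ?m0 //.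
apply/idP/orP => [dv|[dv|/mapP[d' + ->]]]; last first.
- by rewrite -dvdn_divisors // => dv; rewrite dvdn_mul.
- exact: dvdn_mulr.
have [/dvdnP[d' dE]|nqd] := boolP (q %| d)%N.
  right; apply/mapP; exists d' => //; rewrite -dvdn_divisors //.
  by move: dv; rewrite dE dvdn_pmul2r.
by left; rewrite -(Gauss_dvdl _ (_ : coprime d q)) // coprime_sym prime_coprime.
Qed.

Section CyclotomicFactors.

Variables p q : nat.
Hypotheses (hp : prime p) (hq : prime q) (hpq : p <> q).

Let p0 := prime_gt0 hp.
Let q0 := prime_gt0 hq.

Lemma coprime_expl_prime k : coprime (p ^ k) q.
Proof. by rewrite coprimeXl // prime_coprime // dvdn_prime2 //; apply/eqP. Qed.

Lemma prod_Phi_pfactor k : \prod_(i <- iota 0 k.+1) 'Phi_(p ^ i) = 'X^(p ^ k) - 1.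
Proof.
rewrite -prod_Cyclotomic ?expn_gt0 ?p0 //.
by rewrite (perm_big _ (divisors_pfactor _ k hp)) big_map.
Qed.

Lemma perm_divisors_pfactorM k :
  perm_eq (divisors (p ^ k * q))
    ([seq (p ^ i)%N | i <- iota 0 k.+1] ++ [seq (p ^ i * q)%N | i <- iota 0 k.+1]).
Proof.
rewrite (permPl (divisors_mul_prime _ _ _ hq (coprime_expl_prime k))) ?expn_gt0 ?p0 //.
have -> : [seq (p ^ i * q)%N | i <- iota 0 k.+1] =
    [seq (d * q)%N | d <- [seq (p ^ i)%N | i <- iota 0 k.+1]] by rewrite -map_comp.
by rewrite perm_cat ?perm_map ?divisors_pfactor.
Qed.

Lemma prod_Phi_pfactorM k :
  (\prod_(i <- iota 0 k.+1) 'Phi_(p ^ i)) * (\prod_(i <- iota 0 k.+1) 'Phi_(p ^ i * q))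
  = 'X^(p ^ k * q) - 1.
Proof.
rewrite -prod_Cyclotomic ?muln_gt0 ?expn_gt0 ?p0 //.
by rewrite (perm_big _ (perm_divisors_pfactorM k)) big_cat !big_map.
Qed.

Lemma Phi_identities :
  [/\ 'Phi_1 = 'X^1 - 1, 'Phi_1 * 'Phi_p = 'X^p - 1,
      'Phi_1 * 'Phi_q = 'X^q - 1 &
  [/\ 'Phi_1 * 'Phi_p * 'Phi_q * 'Phi_(p * q) = 'X^(p * q) - 1,
      'Phi_1 * 'Phi_p * 'Phi_(p ^ 2) = 'X^(p ^ 2) - 1 &
      'Phi_1 * 'Phi_p * 'Phi_q * 'Phi_(p * q) * 'Phi_(p ^ 2) * 'Phi_(p ^ 2 * q)
        = 'X^(p ^ 2 * q) - 1]].
Proof.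
have := (prod_Phi_pfactor 0, prod_Phi_pfactor 1, prod_Phi_pfactor 2,
         prod_Phi_pfactorM 0, prod_Phi_pfactorM 1, prod_Phi_pfactorM 2).
rewrite /= !big_cons !big_nil !expn0 !expn1 !mulr1 !mul1n => -[[[[[<- <-] <-] <-] <-] <-].
by split=> //; split; ring.
Qed.

Lemma monic_divisor_cases (f : {poly int}) :
  monic_divisor f ('X^(p ^ 2 * q) - 1) ->
  exists a b c d e k : bool,
    f = 'Phi_1 ^+ a * ('Phi_p ^+ b * 'Phi_q ^+ c * 'Phi_(p * q) ^+ d *
        'Phi_(p ^ 2) ^+ e * 'Phi_(p ^ 2 * q) ^+ k).
Proof.
case=> fm [h]; rewrite -prod_Cyclotomic ?muln_gt0 ?expn_gt0 ?p0 //.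
rewrite (perm_big _ (perm_divisors_pfactorM 2)) /= !expn0 !mul1n !expn1 => /esym hf.
have [|_ /subseqP[m szm ->] ->] := monic_factor_prod_Cyclotomic _ f h _ fm hf.
  by rewrite /= !muln_gt0 p0 q0.
case: m szm => [|b0 [|b1 [|b2 [|b3 [|b4 [|b5 []]]]]]] //= _.
(* The divisors are listed as 1, p, p^2, q, p q, p^2 q, whence the place of [b2]. *)
exists b0, b1, b3, b4, b2, b5.
by case: b0; case: b1; case: b2; case: b3; case: b4; case: b5;
  rewrite /= ?big_cons big_nil ?expr0 ?expr1; ring.
Qed.

End CyclotomicFactors.

(** * Products of the six cyclotomic factors *)

Lemma geom_unique m k (g : {poly int}) :
  (0 < m)%N -> ('X^m - 1) * g = 'X^(m * k) - 1 -> g = geom m k.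
Proof. by move=> m0; rewrite -geomP => /(mulfI (Xnsub1_neq0 _ m0)). Qed.

Lemma size_geom1 k : (size (geom 1 k) <= k)%N.
Proof. by rewrite /geom expr1 comp_polyXr size_poly. Qed.

Lemma Phi1E : 'Phi_1 = 'X - 1.
Proof. by have := @prod_Cyclotomic 1 isT; rewrite expr1 /= big_seq1. Qed.

Section SixFactors.

Variables p q : nat.
Hypotheses (hp : prime p) (hq : prime q) (hpq : p <> q).

Let p0 : (0 < p)%N := prime_gt0 hp.
Let q0 : (0 < q)%N := prime_gt0 hq.

Local Notation A := ('Phi_1).
Local Notation P := ('Phi_p).
Local Notation Q := ('Phi_q).
Local Notation R := ('Phi_(p * q)).
Local Notation S := ('Phi_(p ^ 2)).
Local Notation T := ('Phi_(p ^ 2 * q)).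

Lemma coprime_pq : coprime p q.
Proof. by rewrite -[p in coprime p]expn1 coprime_expl_prime. Qed.

Let eA : 'X^1 - 1 = A.
Proof. by have [-> _ _ _] := Phi_identities p q hp hq hpq. Qed.
Let eAP : 'X^p - 1 = A * P.
Proof. by have [_ -> _ _] := Phi_identities p q hp hq hpq. Qed.
Let eAQ : 'X^q - 1 = A * Q.
Proof. by have [_ _ -> _] := Phi_identities p q hp hq hpq. Qed.
Let eAPQR : 'X^(p * q) - 1 = A * P * Q * R.
Proof. by have [_ _ _ [-> _ _]] := Phi_identities p q hp hq hpq. Qed.
Let eAPS : 'X^(p ^ 2) - 1 = A * P * S.
Proof. by have [_ _ _ [_ -> _]] := Phi_identities p q hp hq hpq. Qed.
Let eall : 'X^(p ^ 2 * q) - 1 = A * P * Q * R * S * T.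
Proof. by have [_ _ _ [_ _ ->]] := Phi_identities p q hp hq hpq. Qed.

Lemma Phi_p_geom : P = geom 1 p.
Proof. by apply: geom_unique => //; rewrite mul1n eA eAP. Qed.

Lemma Phi_q_geom : Q = geom 1 q.
Proof. by apply: geom_unique => //; rewrite mul1n eA eAQ. Qed.

Lemma PR_geom : P * R = geom q p.
Proof. by apply: geom_unique => //; rewrite (mulnC q) eAQ eAPQR; ring. Qed.

Lemma QR_geom : Q * R = geom p q.
Proof. by apply: geom_unique => //; rewrite eAP eAPQR; ring. Qed.

Lemma S_geom : S = geom p p.
Proof. by apply: geom_unique => //; rewrite mulnn eAP eAPS; ring. Qed.

Lemma PS_geom : P * S = geom 1 (p ^ 2).
Proof. by apply: geom_unique => //; rewrite mul1n eA eAPS; ring. Qed.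

Lemma PQR_geom : P * Q * R = geom 1 (p * q).
Proof. by apply: geom_unique => //; rewrite mul1n eA eAPQR; ring. Qed.

Lemma ST_geom : S * T = geom (p * q) p.
Proof.
apply: geom_unique; first by rewrite muln_gt0 p0.
by rewrite (mulnC _ p) mulnA mulnn eAPQR eall; ring.
Qed.

Lemma QRT_geom : Q * R * T = geom (p ^ 2) q.
Proof. by apply: geom_unique; rewrite ?expn_gt0 ?p0 // eAPS eall; ring. Qed.

Lemma PRST_geom : P * R * S * T = geom q (p ^ 2).
Proof. by apply: geom_unique => //; rewrite (mulnC q) eAQ eall; ring. Qed.

Lemma QRST_geom : Q * R * S * T = geom p (p * q).
Proof. by apply: geom_unique => //; rewrite mulnA mulnn eAP eall; ring. Qed.

Lemma PQRST_geom : P * Q * R * S * T = geom 1 (p ^ 2 * q).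
Proof. by apply: geom_unique => //; rewrite mul1n eA eall; ring. Qed.

Lemma R_identity : R * ('X^p - 1) * ('X^q - 1) = ('X^1 - 1) * ('X^(p * q) - 1).
Proof. by rewrite eAP eAQ eA eAPQR; ring. Qed.

Lemma flat_R : flat R.
Proof. exact: (flat_coprime_quotient _ _ _ _ p0 q0 coprime_pq R_identity). Qed.

(** Substituting X^p in [R_identity] gives an equation that T satisfies as well; cancelling the
    common factor identifies the two. *)
Lemma T_comp : T = R \Po 'X^p.
Proof.
have := congr1 (fun f : {poly int} => f \Po 'X^p) R_identity.
rewrite !comp_polyM !comp_polyB !comp_Xn_poly !comp_polyC -!exprM muln1 mulnA mulnn.
rewrite polyC1 eAPS eAPQR eAP eall => e.
have nz : A * P * S * (A * P * Q * R) != 0.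
  by rewrite -eAPS -eAPQR mulf_neq0 // Xnsub1_neq0 // ?muln_gt0 ?expn_gt0 p0.
by rewrite -mulrA in e; apply: (mulfI nz); rewrite [RHS]mulrC e; ring.
Qed.

Lemma flat_T : flat T.
Proof. by rewrite T_comp; apply: flat_comp_Xn flat_R. Qed.

(** R T is to the coprime pair p^2, q what R is to p, q. *)
Lemma flat_RT : flat (R * T).
Proof.
have c2 := coprime_expl_prime p q hp hq hpq 2.
apply: (flat_coprime_quotient 1 _ _ _ _ q0 c2); rewrite ?expn_gt0 ?p0 //.
by rewrite eAPS eAQ eA eall; ring.
Qed.

Lemma flat_PRT : flat (P * R * T).
Proof.
have c2 := coprime_expl_prime p q hp hq hpq 2.
apply: (flat_coprime_quotient p _ _ _ _ q0 c2); rewrite ?expn_gt0 ?p0 //.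
by rewrite eAPS eAQ eAP eall; ring.
Qed.

Lemma zero_one_P : zero_one P. Proof. by rewrite Phi_p_geom; apply: zero_one_geom. Qed.
Lemma zero_one_Q : zero_one Q. Proof. by rewrite Phi_q_geom; apply: zero_one_geom. Qed.
Lemma zero_one_S : zero_one S. Proof. by rewrite S_geom; apply: zero_one_geom. Qed.
Lemma zero_one_ST : zero_one (S * T).
Proof. by rewrite ST_geom; apply: zero_one_geom; rewrite muln_gt0 p0. Qed.

Lemma size_Phi_p : (size P <= p)%N. Proof. by rewrite Phi_p_geom size_geom1. Qed.
Lemma size_Phi_q : (size Q <= q)%N. Proof. by rewrite Phi_q_geom size_geom1. Qed.

(** As a polynomial in X^(p q), S T turns a factor of degree below p q into disjoint copies of it;
    P, Q and R are such factors. *)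
Lemma ST_comp : S * T = geom 1 p \Po 'X^(p * q).
Proof. by rewrite geom_comp mul1n ST_geom. Qed.

Lemma zero_one_QST : zero_one (Q * S * T).
Proof.
rewrite -mulrA ST_comp; apply: zero_one_spread; rewrite ?muln_gt0 ?p0 //.
- by rewrite (leq_trans size_Phi_q) ?leq_pmull.
- exact: zero_one_Q.
exact: zero_one_geom.
Qed.

Lemma zero_one_PST : zero_one (P * S * T).
Proof.
rewrite -mulrA ST_comp; apply: zero_one_spread; rewrite ?muln_gt0 ?p0 //.
- by rewrite (leq_trans size_Phi_p) ?leq_pmulr.
- exact: zero_one_P.
exact: zero_one_geom.
Qed.

Lemma zero_one_PQRT : zero_one (P * Q * R * T).
Proof.
rewrite -!mulrA [Q * _]mulrA QRT_geom -[(p ^ 2)%N]mul1n -geom_comp.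
apply: zero_one_spread; rewrite ?expn_gt0 ?p0 //; last exact: zero_one_geom.
- by rewrite (leq_trans size_Phi_p) // -mulnn leq_pmulr.
exact: zero_one_P.
Qed.

Lemma zero_one_PRS : zero_one (P * R * S).
Proof.
rewrite PR_geom S_geom; apply: zero_one_geom_coprime => //.
by rewrite coprime_sym coprime_pq.
Qed.

Lemma flat_RST : flat (R * S * T).
Proof.
rewrite -mulrA ST_comp; apply: flat_spread; rewrite ?muln_gt0 ?p0 //.
- rewrite size_Cyclotomic totient_coprime ?coprime_pq // !totient_prime //.
  by nia.
- exact: flat_R.
exact/zero_one_flat/zero_one_geom.
Qed.

Lemma flat_PT : flat (P * T).
Proof.
rewrite T_comp; apply: flat_spread => //; first exact: size_Phi_p.
  exact/zero_one_flat/zero_one_P.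
exact: flat_R.
Qed.

Lemma flat_A : flat A.
Proof. by rewrite -eA => i; rewrite coefB coefXn coef1; case: i => [|[]]. Qed.

Lemma size_A : size A = 2%N. Proof. by rewrite size_Cyclotomic. Qed.

(** T is a polynomial in X^p and p does not divide q, so the exponents of X^q T and of T lie in
    different classes modulo p and never meet. *)
Lemma flat_AQT : flat (A * Q * T).
Proof.
rewrite -eAQ T_comp => n; rewrite coefXnsub1M !coef_comp_poly_Xn //.
move: (flat_R (n %/ p)%N) (flat_R ((n - q) %/ p)%N).
move: (R`_(n %/ p)) (R`_((n - q) %/ p)) => x y Rx Ry.
case: ltnP => leqn; first by case: (p %| n)%N; lia.
suff : ~~ ((p %| n)%N && (p %| n - q)%N).
  case: (p %| n)%N; case: (p %| _)%N => //= _; lia.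
apply: contraL coprime_pq => /andP[dn dnq]; rewrite prime_coprime // negbK.
by rewrite -(dvdn_addr _ dnq) subnK.
Qed.

Lemma Phi_neq0 n : 'Phi_n != 0. Proof. by rewrite monic_neq0 ?Cyclotomic_monic. Qed.

Lemma self_reciprocal_A : self_reciprocal (- 1) A.
Proof. by rewrite -eA; apply: self_reciprocal_Xnsub1. Qed.

Let sr_div (f g : {poly int}) n : (0 < n)%N -> f != 0 -> g != 0 ->
  self_reciprocal (- 1) f -> 'X^n - 1 = f * g -> self_reciprocal 1 g.
Proof.
move=> n0 f0 g0 rf fg; have := self_reciprocal_divl (- 1) (- 1) f g.
by rewrite mulrNN mulr1; apply; rewrite // -fg; apply: self_reciprocal_Xnsub1.
Qed.

Lemma self_reciprocal_factors :
  [/\ self_reciprocal 1 P, self_reciprocal 1 Q, self_reciprocal 1 R,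
      self_reciprocal 1 S & self_reciprocal 1 T].
Proof.
have sA := self_reciprocal_A; have nz := Phi_neq0.
have sM (f g : {poly int}) : f != 0 -> g != 0 -> self_reciprocal (- 1) f ->
    self_reciprocal 1 g -> self_reciprocal (- 1) (f * g).
  by move=> f0 g0 sf sg; rewrite -[- 1]mulr1; apply: self_reciprocalM.
have sP : self_reciprocal 1 P by exact: sr_div p0 _ _ sA eAP.
have sQ : self_reciprocal 1 Q by exact: sr_div q0 _ _ sA eAQ.
have sR : self_reciprocal 1 R.
  apply: sr_div eAPQR; rewrite ?muln_gt0 ?p0 ?mulf_neq0 //.
  by do 2!(apply: (sM) => //; rewrite ?mulf_neq0 //).
have sS : self_reciprocal 1 S.
  by apply: sr_div eAPS; rewrite ?expn_gt0 ?p0 ?mulf_neq0 //; apply: sM.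
split=> //; apply: sr_div eall; rewrite ?muln_gt0 ?expn_gt0 ?p0 ?mulf_neq0 //.
by do 4!(apply: (sM) => //; rewrite ?mulf_neq0 //).
Qed.

End SixFactors.

(** * The product ARS *)

(** Counts the i < a with i <= n, minus those with n - i >= b. The proof follows the recurrence
    obtained by multiplying by X - 1. *)
Lemma coef_geom1_mul a b n :
  (geom 1 a * geom 1 b)`_n = (minn n.+1 a)%:Z - (minn (n.+1 - b) a)%:Z.
Proof.
have rec m : (geom 1 a * geom 1 b)`_m =
    (if m is m'.+1 then (geom 1 a * geom 1 b)`_m' else 0)
    + (m < b)%N%:Z - (a <= m < a + b)%N%:Z.
  have := congr1 (fun f : {poly int} => (f * geom 1 b)`_m) (geomP 1 a).
  rewrite -mulrA !coefXnsub1M !coef_geom // !dvd1n !muln1 mul1n subn1 /= !natz.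
  by case: m => [|m] /=; case: (ltnP _ a) => lt; lia.
elim: n => [|n IH]; rewrite rec; first by lia.
by rewrite IH; lia.
Qed.

Lemma minn_lipschitz a b d p :
  (a <= b <= a + d)%N -> (minn a p <= minn b p <= minn a p + minn p d)%N.
Proof. lia. Qed.

(* The left hand side rises with slopes 1, 2, 1 to [minn p x + minn p y] and falls back to 0;
   a slope 2 skips even values on one side and odd values on the other. *)
Lemma double_ramp_onto p x y w : (x <= y)%N -> odd (x + y) ->
  (w <= minn p x + minn p y)%N ->
  exists k, (minn k p).*2 = (w + minn (k - x) p + minn (k - y) p)%N.
Proof.
move=> lexy oddxy lew.
have [odd_w|even_w] := boolP (odd w); last first.
  have [le2x|lt2x] := leqP w x.*2; [have [le2p|lt2p] := leqP w p.*2|].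
  - by exists w./2; lia.
  - by exists w; lia.
  by exists (w - x)%N; lia.
have [lt_pd|le_dp] := leqP (x + p) y.
  have [lewp|ltpw] := leqP w p; first by exists (y + p - w)%N; lia.
  have [ltw|lew2] := leqP (p.*2 + x - w)%N p; last by exists (p.*2 + x - w)%N; lia.
  by exists (w - x)%N; lia.
have [lewd|ltdw] := leqP w (y - x); first by exists (y + p - w)%N; lia.
have [lewx|ltxw] := leqP x.*2 w.
  by exists (w - x)%N; lia.
have [le_w|lt_w] := leqP w (p.*2 - (y - x)).
  (* On the stretch of slope -2 the value at k is [p.*2 + (x + y) - k.*2], which is odd. *)
  by exists (p.*2 + (x + y) - w)./2; lia.
by exists (p.*2 + x - w)%N; lia.
Qed.

Section RSFactor.

Variables p q : nat.
Hypotheses (hp : prime p) (hq : prime q) (hpq : p <> q).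

Let p0 : (0 < p)%N := prime_gt0 hp.
Let q0 : (0 < q)%N := prime_gt0 hq.

Local Notation A := ('Phi_1).
Local Notation P := ('Phi_p).
Local Notation R := ('Phi_(p * q)).
Local Notation S := ('Phi_(p ^ 2)).

(** Below index [p * L] this agrees with the power series P R S / (1 - X^p), so that A R S is there,
    up to sign, the second difference of [C L] ([F_C]). *)
Let C L : {poly int} := geom q p * ((geom 1 p * geom 1 L) \Po 'X^p).

Let F_C L : A * R * S * ('X^(p * L) - 1) = ('X^1 - 1) * (('X^1 - 1) * C L).
Proof.
have [_ eAP _ _] := Phi_identities p q hp hq hpq.
rewrite /C comp_polyM !geom_comp !mul1n -(S_geom p q) // -PR_geom // -(geomP p L) expr1 -Phi1E -eAP.
ring.
Qed.

(** The numbers q j with j < p represent each class modulo p once, so a single term of [geom q p]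
    meets the index [n], and y - z is the quotient (n - q j) / p. The offset [z] keeps everything in
    nat; truncated subtraction gives the value 0 when n < q j. *)
Let C_coef L n j y z : (n < p * L)%N -> (j < p)%N -> (n + p * z = q * j + p * y)%N ->
  (C L)`_n = (minn (y.+1 - z) p)%:Z.
Proof.
move=> ltn ltj nE; rewrite coefM.
have uniq i : (i < p)%N -> (q * i <= n)%N -> (p %| n - q * i)%N -> i = j.
  move=> lti lei dvi; suff : (i == j %[mod p])%N by rewrite !modn_small // => /eqP.
  have cpq := coprime_pq p q hp hq hpq.
  have : (n + p * z == q * i %[mod p])%N.
    by rewrite (mulnC p) addnC modnMDl eqn_mod_dvd.
  rewrite nE addnC (mulnC p) modnMDl; have [leij|/ltnW leji] := leqP i j.
    by rewrite eqn_mod_dvd ?leq_mul2l ?leij ?orbT // -mulnBr Gauss_dvdr // eq_sym eqn_mod_dvd.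
  by rewrite eq_sym eqn_mod_dvd ?leq_mul2l ?leji ?orbT // -mulnBr Gauss_dvdr // eqn_mod_dvd.
have zero (i : 'I_n.+1) : (i != q * j :> nat)%N ->
    (geom q p)`_i * (geom 1 p * geom 1 L \Po 'X^p)`_(n - i) = 0.
  move=> ne; rewrite coef_geom // coef_comp_poly_Xn //.
  case: dvdnP => [[i' iE]|_]; last by rewrite mul0r.
  case: (ltnP i (p * q)) => lti; last by rewrite mul0r.
  case: (boolP (p %| n - i)%N) => dvi; last by rewrite mulr0.
  case/eqP: ne; rewrite iE mulnC; congr (_ * _)%N; apply: uniq.
  - by move: lti; rewrite iE ltn_pmul2r.
  - by rewrite mulnC -iE -ltnS.
  by rewrite mulnC -iE.
have [le|lt] := leqP (q * j) n; last first.
  rewrite big1 => [|i _]; last by apply: zero; have := ltn_ord i; lia.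
  suff -> : (y.+1 - z = 0)%N by rewrite min0n.
  apply/eqP; rewrite subn_eq0 -(ltn_pmul2l p0); lia.
rewrite (bigD1 (Ordinal (le : (_ < n.+1)%N))) //= big1 ?addr0; last first.
  by move=> i /eqP ne; apply: zero; apply/eqP => ie; case: ne; apply: val_inj.
have lezy : (z <= y)%N by rewrite -(leq_pmul2l p0); lia.
have -> : (n - q * j = (y - z) * p)%N by rewrite mulnBl !(mulnC _ p); lia.
rewrite coef_geom // coef_comp_poly_Xn // dvdn_mulr // mulnC ltn_pmul2r // ltj dvdn_mull //.
rewrite mulnK // mul1r coef_geom1_mul -(subSn lezy) (_ : _ - L = 0)%N ?min0n ?subr0 //.
by apply/eqP; rewrite subn_eq0 subSn // -(ltn_pmul2l p0) mulnBr; lia.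
Qed.

Let inverse_mod : exists u e : nat, [/\ (0 < u < p)%N, (0 < e < q)%N & (q * u = 1 + p * e)%N].
Proof.
have p1 := prime_gt1 hp; have q1 := prime_gt1 hq.
have /(coprimeP _ q0)[[u v] /= uv] : coprime q p by rewrite coprime_sym coprime_pq //.
have uE : (q * (u %% p) = 1 %[mod p])%N.
  by rewrite modnMmr mulnC -(subnK (_ : v * p <= u * q)%N) ?uv; [rewrite addnC modnMDl|lia].
have u0 : (0 < u %% p)%N.
  by rewrite lt0n; apply/eqP => z; move: uE; rewrite z muln0 mod0n modn_small.
exists (u %% p)%N, (q * (u %% p) %/ p)%N; have ltu := ltn_pmod u p0.
have e := divn_eq (q * (u %% p)) p; rewrite uE (modn_small p1) in e.
split; [by rewrite u0 | | by rewrite (mulnC p) addnC].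
apply/andP; split; last by rewrite ltn_divLR // ltn_pmul2l.
rewrite lt0n; apply/eqP => z; move: e; rewrite z => e; nia.
Qed.

Section Inverse.

Variables u e : nat.
Hypotheses (ltu : (0 < u < p)%N) (lte : (0 < e < q)%N) (que : (q * u = 1 + p * e)%N).

(** Passing from index n + 1 to n replaces j by j - u modulo p. This raises y - z by e if j >= u and
    lowers it by q - e otherwise, and truncation at p is 1-Lipschitz. *)
Let D_bounds L n : (n < p * L)%N ->
  - (minn p (q - e))%:Z <= (('X^1 - 1) * C L)`_n <= (minn p e)%:Z.
Proof.
have p1 := prime_gt1 hp.
case: n => [|n] ltn; rewrite coefXnsub1M /=.
  by rewrite (C_coef L 0 0 0 0) //; lia.
rewrite subn1 /=; pose j := (u * n.+1 %% p)%N; have ltj : (j < p)%N by rewrite ltn_pmod.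
have jE : (n.+1 + p * (q * j) = q * j %[mod p])%N.
  rewrite (mulnC p) addnC modnMDl modnMmr mulnA que mulnDl mul1n -mulnA addnC.
  by rewrite (mulnC p) modnMDl.
have le : (q * j <= n.+1 + p * (q * j))%N by rewrite (leq_trans (leq_pmull _ p0)) ?leq_addl.
have /dvdnP[y yE] : (p %| n.+1 + p * (q * j) - q * j)%N by rewrite -eqn_mod_dvd //; apply/eqP.
have nE : (n.+1 + p * (q * j) = q * j + p * y)%N by rewrite (mulnC p y) -yE subnKC.
rewrite (C_coef L n.+1 j y (q * j)) //; set z := (q * j)%N in nE *.
have [leuj|ltju] := leqP u j.
  rewrite (C_coef L n (j - u) (y + e) z) //; [| exact: ltnW | lia |].
    have : (y.+1 - z <= (y + e).+1 - z <= y.+1 - z + e)%N by clear; lia.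
    by move/(minn_lipschitz _ _ _ p); clear; lia.
  rewrite mulnBr que -/z mulnDr; have : (q * u <= z)%N by rewrite leq_mul2l leuj orbT.
  by rewrite que; move: nE; clear; lia.
rewrite (C_coef L n (j + p - u) (y + e) (z + q)) //; [| exact: ltnW | lia |].
  have : ((y + e).+1 - (z + q) <= y.+1 - z <= (y + e).+1 - (z + q) + (q - e))%N.
    by move: lte; clear; lia.
  by move/(minn_lipschitz _ _ _ p); clear; lia.
rewrite mulnBr mulnDr que -/z !mulnDr (mulnC p q).
have : (q * u <= q * p)%N by rewrite leq_mul2l; lia.
by rewrite que; move: nE; clear; lia.
Qed.

Let F_coef n : (A * R * S)`_n =
  (('X^1 - 1) * C n.+1)`_n - (if (n < 1)%N then 0 else (('X^1 - 1) * C n.+1)`_(n - 1)).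
Proof.
have := congr1 (fun f : {poly int} => f`_n) (F_C n.+1); rewrite mulrC !coefXnsub1M.
by rewrite leq_pmull // sub0r => /eqP; rewrite eqr_oppLR opprB => /eqP ->.
Qed.

Lemma ARS_bound n : `|(A * R * S)`_n| <= (minn p e + minn p (q - e))%:Z.
Proof.
have ltn : (n < p * n.+1)%N by rewrite leq_pmull.
have := D_bounds n.+1 n ltn; have := D_bounds n.+1 (n - 1) (leq_ltn_trans (leq_subr 1 n) ltn).
by rewrite F_coef; case: ifP; lia.
Qed.

(** The three indices 1 + p k, p k and p k - 1 of the second difference have j = u, 0 and p - u. *)
Lemma ARS_class1 k : (A * R * S)`_(1 + p * k) =
  (minn k.+1 p).*2%:Z - (minn (k.+1 - e) p)%:Z - (minn (k.+1 - (q - e)) p)%:Z.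
Proof.
rewrite F_coef; set L := (1 + p * k).+1.
have ltL n : (n <= 1 + p * k)%N -> (n < p * L)%N.
  by move=> le; rewrite (leq_ltn_trans le) // leq_pmull.
rewrite !coefXnsub1M (_ : 1 + p * k - 1 = p * k)%N; last lia.
rewrite (C_coef L (p * k) 0 k 0); [|by apply: ltL; lia | lia | lia].
rewrite (C_coef L (1 + p * k) u k e); [|by apply: ltL; lia | lia | lia].
case: k @L ltL => [|k] L ltL; first by rewrite muln0 /=; lia.
rewrite (C_coef L (p * k.+1 - 1) (p - u) (k.+1 + e) q); [| by apply: ltL; lia | lia |].
  by rewrite /= ifF; lia.
rewrite mulnBr que !mulnDr mulnS (mulnC p q).
have : (q * u <= q * p)%N by rewrite leq_mul2l; lia.
by rewrite que; lia.
Qed.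

End Inverse.

Lemma ARS_convex : coef_convex (A * R * S).
Proof.
have [u [e [ltu lte que]]] := inverse_mod.
have [_ _ sR sS _] := self_reciprocal_factors p q hp hq hpq.
have sF : self_reciprocal (- 1) (A * R * S).
  have sA := self_reciprocal_A p q hp hq hpq.
  rewrite -[- 1]mulr1 -{1}[- 1]mulr1.
  by do 2!(apply: self_reciprocalM => //; rewrite ?mulf_neq0 ?Phi_neq0 //).
have bound := ARS_bound u e ltu lte que.
have [odd_q|even_q] := boolP (odd q); last first.
  have q2 : q = 2%N by have [->//|] := even_prime hq; rewrite (negbTE even_q).
  (* If q = 2, then e = q - e = 1 and the bound is 2. *)
  apply: anti_reciprocal_convex sF _ _; first by rewrite !monicMl ?Cyclotomic_monic.
  by move=> i; have := bound i; lia.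
have onto w : (w <= minn p e + minn p (q - e))%N -> exists j, (A * R * S)`_j = w%:Z.
  move=> lew; have [k kE] : exists k,
      (minn k p).*2 = (w + minn (k - e) p + minn (k - (q - e)) p)%N.
    have [le|/ltnW le] := leqP e (q - e); first by apply: double_ramp_onto; rewrite ?subnKC; lia.
    have [||k kE] := double_ramp_onto p (q - e) e w le; [by rewrite subnK; lia | lia |].
    by exists k; lia.
  (* The ramps of [ARS_class1] are read at k + 1; the remaining place 0 forces w = 0, a value taken
     beyond the degree. *)
  case: k kE => [|k] kE; first by exists (size (A * R * S)); rewrite nth_default //; lia.
  by exists (1 + p * k)%N; rewrite (ARS_class1 u e) // kE; lia.
apply: coef_convexP => i c ic; have := bound i => bi.
have [|j jE] := onto `|c|%N; first by lia.
have [c0|c0] := leP 0 c; first by exists j; rewrite jE; lia.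
by have [k kE] := anti_reciprocal_coefN _ j sF; exists k; rewrite kE jE; lia.
Qed.

End RSFactor.

(** * The product PQT *)

Section PQTFactor.

Variables p q : nat.
Hypotheses (hp : prime p) (hq : prime q) (hpq : p <> q).

Let p0 : (0 < p)%N := prime_gt0 hp.
Let q0 : (0 < q)%N := prime_gt0 hq.
Let p1 : (1 < p)%N := prime_gt1 hp.
Let q1 : (1 < q)%N := prime_gt1 hq.

Local Notation A := ('Phi_1).
Local Notation P := ('Phi_p).
Local Notation Q := ('Phi_q).
Local Notation R := ('Phi_(p * q)).
Local Notation T := ('Phi_(p ^ 2 * q)).

(* Below index [p * L], [H L] is the indicator of the numerical semigroup generated
   by [p] and [q]. *)
Let H L : {poly int} := geom q p * geom p L.

Let W L : {poly int} := P * (P * (H L \Po 'X^p)).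

Let H_step L : ('X^1 - 1) * H L = R * ('X^(p * L) - 1).
Proof.
have [eA eAP _ _] := Phi_identities p q hp hq hpq.
by rewrite /H -geomP -eAP -PR_geom // -eA; ring.
Qed.

Let F_W L : P * Q * T * ('X^(p * (p * L)) - 1) = ('X^q - 1) * W L.
Proof.
have [_ eAP eAQ _] := Phi_identities p q hp hq hpq.
have := congr1 (fun f : {poly int} => f \Po 'X^p) (H_step L).
rewrite /= (comp_polyM _ (H L)) (comp_polyM R) !comp_polyB !comp_Xn_poly comp_polyC polyC1.
rewrite -!exprM muln1 -T_comp //.
by rewrite -eAP -eAQ /W => e; rewrite -mulrA -e; ring.
Qed.

Let F_coef L n : (n < p * (p * L))%N ->
  (P * Q * T)`_n = (W L)`_n - (if (n < q)%N then 0 else (W L)`_(n - q)).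
Proof.
move=> ltn; have := congr1 (fun f : {poly int} => f`_n) (F_W L).
by rewrite mulrC !coefXnsub1M ltn sub0r => /eqP; rewrite eqr_oppLR opprB => /eqP.
Qed.

Let H01 L : zero_one (H L).
Proof. by apply: zero_one_geom_coprime; rewrite // coprime_sym coprime_pq. Qed.

(** The triangle of coefficients of P^2 is cut into its two flanks. Hence W interpolates linearly
    between p times consecutive values of H, the previous one being delivered by ['X * H L]. *)
Let W_coef L n : (W L)`_n = (n %% p).+1%:Z * (H L)`_(n %/ p)
  + (p - (n %% p).+1)%N%:Z * ('X * H L)`_(n %/ p).
Proof.
pose T1 : {poly int} := \poly_(i < p) i.+1%:Z.
pose T2 : {poly int} := \poly_(i < p) (p - i.+1)%N%:Z.
have PP : P * P = T1 + T2 * 'X^p.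
  rewrite (Phi_p_geom p q) //; apply/polyP => i; rewrite coefD coefMXn !coef_poly coef_geom1_mul.
  by case: (ltnP i p) => lti; [lia | case: ifP => lti2; lia].
have -> : W L = T1 * (H L \Po 'X^p) + T2 * (('X * H L) \Po 'X^p).
  by rewrite /W mulrA PP (comp_polyM 'X) comp_polyX; ring.
by rewrite coefD (coef_mul_comp_Xn T1) ?(coef_mul_comp_Xn T2) ?size_poly // !coef_poly ltn_pmod.
Qed.

Let XH01 L i : 0 <= ('X * H L)`_i <= 1.
Proof. by rewrite coefXM; case: eqP => // _; apply: H01. Qed.

Let W_range L n : 0 <= (W L)`_n <= p%:Z.
Proof.
rewrite W_coef; have := H01 L (n %/ p)%N; have := XH01 L (n %/ p)%N.
have := ltn_pmod n p0; move: (n %% p)%N (H L)`_(n %/ p) ('X * H L)`_(n %/ p) => r x y ltr.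
by nia.
Qed.

(** (X - 1) W = (X^p - 1) P H(X^p), and P H(X^p) repeats each value of H, 0 or 1, p times. *)
Let W_step L n : `|(W L)`_n.+1 - (W L)`_n| <= 1.
Proof.
have [eA eAP _ _] := Phi_identities p q hp hq hpq.
have : flat (('X^1 - 1) * W L).
  rewrite (_ : _ * _ = ('X^p - 1) * (P * (H L \Po 'X^p))); last by rewrite -eA -eAP /W; ring.
  apply/zero_one_flat_step/zero_one_spread => //; first exact: (size_Phi_p p q).
  exact: (zero_one_P p q).
by move/(_ n.+1); rewrite coefXnsub1M /= subn1 /=; lia.
Qed.

Let W_lipschitz L n d : `|(W L)`_(n + d) - (W L)`_n| <= d%:Z.
Proof.
elim: d => [|d IH]; first by rewrite addn0 subrr normr0.
by have := W_step L (n + d); rewrite addnS; lia.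
Qed.

Let H_low L k : (k < q)%N -> (H L)`_k = ((p %| k)%N && (k < L * p)%N)%:R.
Proof.
move=> ltk; rewrite coefM big_ord_recl big1 => [|i _].
  by rewrite subn0 !coef_geom // dvdn0 muln_gt0 p0 q0 mul1r addr0.
rewrite coef_geom // [X in X * _](_ : _ = 0) ?mul0r //.
rewrite gtnNdvd //=; exact: leq_ltn_trans (ltn_ord i) ltk.
Qed.

Let H0 L : (0 < L)%N -> (H L)`_0 = 1.
Proof. by move=> L0; rewrite H_low // dvdn0 muln_gt0 L0 p0. Qed.

Let H1 L : (H L)`_1 = 0.
Proof. by rewrite H_low // dvdn1 (gtn_eqF p1). Qed.

(** Adding p stays in the semigroup: the increment from k - p to k is a coefficient of
    [geom q p]. *)
Let H_mono L k i : (k < p * L)%N -> (p * i <= k)%N -> (H L)`_(k - p * i) <= (H L)`_k.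
Proof.
have step m : (m < p * L)%N -> (p <= m)%N -> (H L)`_(m - p) <= (H L)`_m.
  move=> ltm lem; have e : ('X^p - 1) * H L = ('X^(p * L) - 1) * geom q p.
    by rewrite /H -(geomP p L); ring.
  have := congr1 (fun f : {poly int} => f`_m) e.
  rewrite /= !coefXnsub1M ltm ltnNge lem /=; have := zero_one_geom q p q0 m.
  by move: (H L)`_m (H L)`_(m - p) (geom q p)`_m => x y z; lia.
elim: i k => [|i IH] k ltk le; first by rewrite muln0 subn0.
have lepk : (p <= k)%N by rewrite (leq_trans _ le) // leq_pmulr.
apply: le_trans (step k ltk lepk); rewrite mulnS subnDA; apply: IH.
  exact: leq_ltn_trans (leq_subr _ _) ltk.
by rewrite leq_subRL // -mulnS.
Qed.

(** A shift by p^2 i moves by p i blocks and keeps the position in the block, so that neither end of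
    the interpolation decreases, by [H_mono]. *)
Let W_mono L n i : (n < p * (p * L))%N -> (p ^ 2 * i <= n)%N ->
  (W L)`_(n - p ^ 2 * i) <= (W L)`_n.
Proof.
move=> ltn le; rewrite !W_coef.
have eN : (p ^ 2 * i = p * i * p)%N by rewrite -mulnn; lia.
have le' : (p * i <= n %/ p)%N by rewrite leq_divRL // -eN.
have ltk : (n %/ p < p * L)%N by rewrite ltn_divLR // mulnC.
have -> : (n - p ^ 2 * i = (n %/ p - p * i) * p + n %% p)%N.
  by rewrite eN {1}(divn_eq n p) mulnBl addnBAC // leq_mul2r le' orbT.
rewrite modnMDl modn_mod divnMDl // (divn_small (ltn_pmod n p0)) addn0.
apply: lerD; apply: ler_wpM2l => //; first exact: H_mono.
rewrite !coefXM; case: (posnP (n %/ p - p * i)) => [_|pos].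
  by case: eqP => // _; have := H01 L (n %/ p).-1; lia.
rewrite ifF; last by apply/eqP; lia.
rewrite (_ : (n %/ p - p * i).-1 = (n %/ p).-1 - p * i)%N; last lia.
by apply: H_mono; lia.
Qed.

Let W_first L n : (0 < L)%N -> (n < p)%N -> (W L)`_n = n.+1%:Z.
Proof.
move=> L0 ltn; rewrite W_coef divn_small // modn_small // H0 // coefXM eqxx.
by rewrite mulr0 addr0 mulr1.
Qed.

Let W_second L n : (0 < L)%N -> (p.-1 <= n < p.*2)%N -> (W L)`_n = (p.*2 - n.+1)%N%:Z.
Proof.
move=> L0 /andP[len ltn]; have [ltnp|lepn] := ltnP n p.
  by rewrite W_first //; lia.
rewrite W_coef -(subnK lepn) divnDr ?dvdnn // modnDr divnn p0.
rewrite divn_small ?modn_small ?add0n; [|lia|lia].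
by rewrite H1 mulr0 add0r coefXM /= H0 // mulr1; lia.
Qed.

(** The block k = n / p is below q, where H only contains multiples of p. From residue 2p - 1 modulo
    p^2 on, k is no multiple of p, and if k - 1 is one, the residue is 2p - 1 and the weight of k -
    1 is 0. *)
Let W_zero L n : (n < p * (p * L))%N -> (n < p * q)%N -> (p.*2.-1 <= n %% p ^ 2)%N ->
  (W L)`_n = 0.
Proof.
move=> ltn ltq lez; set i := (n %/ p ^ 2)%N; set z := (n %% p ^ 2)%N in lez.
have ltz : (z < p * p)%N by rewrite mulnn ltn_pmod // expn_gt0 p0.
have kE : (n %/ p = p * i + z %/ p)%N.
  by rewrite {1}(divn_eq n (p ^ 2)) -/i -/z -mulnn mulnA divnMDl // mulnC.
have rE : (n %% p = z %% p)%N by rewrite /z -mulnn modn_dvdm // dvdn_mulr.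
have ltk : (n %/ p < q)%N by rewrite ltn_divLR // mulnC.
have z1 : (0 < z %/ p < p)%N by rewrite divn_gt0 // ltn_divLR //; lia.
have zE := divn_eq z p; have ltr := ltn_pmod z p0.
rewrite W_coef H_low // kE rE -[(p %| _)%N]/(_ %% _ == 0)%N (mulnC p i) modnMDl.
rewrite (modn_small (_ : z %/ p < p)%N); last by case/andP: z1.
rewrite gtn_eqF ?mulr0 ?add0r; last by lia.
rewrite coefXM; case: eqP => [|_]; first by rewrite mulr0.
have [z1E|z1N] := eqVneq (z %/ p)%N 1%N.
  suff -> : (p - (z %% p).+1 = 0)%N by rewrite mul0r.
  by rewrite z1E mul1n in zE; lia.
rewrite H_low; last by rewrite mulnC -kE; lia.
rewrite (_ : (i * p + z %/ p).-1 = i * p + (z %/ p).-1)%N; last by lia.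
rewrite -[(p %| _)%N]/(_ %% _ == 0)%N modnMDl.
rewrite (modn_small (_ : (z %/ p).-1 < p)%N); last by lia.
by rewrite gtn_eqF ?mulr0 //; lia.
Qed.

(** Both terms of W_n - W_(n-q) vanish: the second one is absent for n < q, and otherwise is read at
    2p - 1, the first zero of W. *)
Lemma PQT_zero n : (n < p * q)%N -> (p.*2.-1 <= n %% p ^ 2)%N ->
  (q <= n)%N ==> (n - q == p.*2.-1)%N -> (P * Q * T)`_n = 0.
Proof.
move=> ltn lez wn; pose L := n.+1.
have ltL m : (m <= n)%N -> (m < p * (p * L))%N.
  by move=> lem; rewrite (leq_ltn_trans lem) // mulnA leq_pmull // muln_gt0 p0.
rewrite (F_coef L) ?ltL // W_zero ?ltL //; case: ltnP wn => // leqn /= /eqP ->.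
by rewrite W_second //; lia.
Qed.

Let F_upper n : (P * Q * T)`_n <= (minn p q)%:Z.
Proof.
have ltn : (n < p * (p * n.+1))%N by rewrite mulnA leq_pmull // muln_gt0 p0.
rewrite (F_coef n.+1) //; have := W_range n.+1 n; case: ltnP => [ltnq|leqn].
  have := W_lipschitz n.+1 0 n; rewrite add0n (W_first _ 0) //; lia.
have := W_range n.+1 (n - q); have := W_lipschitz n.+1 (n - q) q; rewrite subnK //; lia.
Qed.

Let F_lower i n : - (minn p `|q%:Z - (p ^ 2 * i)%N%:Z|%N)%:Z <= (P * Q * T)`_n.
Proof.
have ltn : (n < p * (p * n.+1))%N by rewrite mulnA leq_pmull // muln_gt0 p0.
rewrite (F_coef n.+1) //; have := W_range n.+1 n; case: ltnP => [ltnq|leqn]; first by lia.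
have := W_range n.+1 (n - q).
have [leqi|/ltnW leiq] := leqP (p ^ 2 * i) q.
  have := W_lipschitz n.+1 (n - q) (q - p ^ 2 * i).
  have := W_mono n.+1 n i ltn (leq_trans leqi leqn).
  by rewrite (_ : n - q + (q - p ^ 2 * i) = n - p ^ 2 * i)%N; lia.
have [lein|ltni] := leqP (p ^ 2 * i) n.
  have := W_lipschitz n.+1 (n - p ^ 2 * i) (p ^ 2 * i - q).
  have := W_mono n.+1 n i ltn lein.
  by rewrite (_ : n - p ^ 2 * i + (p ^ 2 * i - q) = n - q)%N; lia.
(* Here n < p^2 i, and W_0 = 1 gives W_(n-q) <= n - q + 1 <= p^2 i - q. *)
have := W_lipschitz n.+1 0 (n - q); rewrite add0n (W_first _ 0) //; lia.
Qed.

Let F_first w : (0 < w <= minn p q)%N -> (P * Q * T)`_w.-1 = w%:Z.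
Proof.
case: w => // w /andP[_ lew] /=; rewrite (F_coef w.+1).
  by rewrite W_first // ?ifT ?subr0 //; lia.
by rewrite mulnA (leq_trans (ltnSn w)) // leq_pmull // muln_gt0 p0.
Qed.

Let F_minus n : (q <= n < p * q)%N -> (p.*2.-1 <= n %% p ^ 2)%N ->
  (P * Q * T)`_n = - (W n.+1)`_(n - q).
Proof.
move=> /andP[leqn ltn] lez; have ltL : (n < p * (p * n.+1))%N.
  by rewrite mulnA leq_pmull // muln_gt0 p0.
by rewrite (F_coef n.+1) // W_zero // ltnNge leqn sub0r.
Qed.

(** Where W_n = 0, the coefficient at n = q + t is - W_t, and W_t runs through 1, ..., p on either
    flank of the first triangle. The residue d of q modulo p^2 decides which flank is used. *)
Let F_negative : (2 < p)%N -> (2 < q)%N -> exists m : nat,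
  (forall n, - m%:Z <= (P * Q * T)`_n) /\
  (forall w, (0 < w <= m)%N -> exists n, (P * Q * T)`_n = - w%:Z).
Proof.
move=> p2 q2; have pp0 : (0 < p ^ 2)%N by rewrite expn_gt0 p0.
have [i [d [qE ltd]]] : exists i d, q = (p ^ 2 * i + d)%N /\ (d < p ^ 2)%N.
  exists (q %/ p ^ 2)%N, (q %% p ^ 2)%N; rewrite ltn_pmod //; split=> //.
  by rewrite mulnC; apply: divn_eq.
(* This is (p - 1) (p - 3) >= 0; it makes each d > p^2 - (2p - 1) at least 2p - 1. *)
have pp3 : (4 * p <= p ^ 2 + 3)%N by rewrite -mulnn; move: p2; clear; nia.
have pq2 : (q + p.*2 <= p * q)%N by move: p2 q2; clear; nia.
have mod_n t : (d + t < p ^ 2)%N -> ((q + t) %% p ^ 2 = d + t)%N.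
  by move=> lt; rewrite {1}qE -addnA mulnC modnMDl modn_small.
have absE (a b x : nat) : a = (b + x)%N -> x = `|a%:Z - b%:Z|%N by lia.
have absE' (a b x : nat) : (a + x = b)%N -> x = `|a%:Z - b%:Z|%N by lia.
have [led|ltd'] := leqP d (p ^ 2 - p.*2.-1).
  exists (minn p d); split=> [n|w /andP[w0 lew]].
    by have := F_lower i n; rewrite -(absE q (p ^ 2 * i)%N d).
  (* The falling flank has W_t = w at t = 2p - 1 - w, and w <= d moves d + t to 2p - 1 or beyond. *)
  exists (q + (p.*2 - w.+1))%N; rewrite F_minus ?mod_n; [|lia..].
  by rewrite addKn W_second //; lia.
exists (minn p (p ^ 2 - d)); split=> [n|w /andP[w0 lew]].
  have := F_lower i.+1 n; rewrite -(absE' q (p ^ 2 * i.+1)%N (p ^ 2 - d)%N) //.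
  by rewrite mulnS {1}qE -addnA subnKC ?(ltnW ltd) // [RHS]addnC.
(* The rising flank has W_t = w at t = w - 1, and d is already at least 2p - 1. *)
exists (q + w.-1)%N; rewrite F_minus ?mod_n; [|lia..].
by rewrite addKn W_first //; lia.
Qed.

Lemma PQT_convex : q <> 2%N -> coef_convex (P * Q * T).
Proof.
move=> q_neq2; have q2 : (2 < q)%N by lia.
have nz : exists j, (P * Q * T)`_j = 0 by exists (size (P * Q * T)); rewrite nth_default.
apply: coef_convexP => n c nc; have up := F_upper n.
have pos w : (0 < w <= minn p q)%N -> exists j, (P * Q * T)`_j = w%:Z.
  by move=> /F_first; exists w.-1.
have [c0|c0|<- //] := ltrgtP 0 c.
  by have [|j jE] := pos `|c|%N; [lia | exists j; rewrite jE; lia].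
have [p2|lep2] := ltnP 2 p.
  have [m [low neg]] := F_negative p2 q2.
  have [|j jE] := neg `|c|%N; first by have := low n; lia.
  by exists j; rewrite jE; lia.
have p2 : p = 2%N by lia.
have odd_q : odd q by case: (even_prime hq).
have low : -1 <= (P * Q * T)`_n.
  (* An odd q is at distance 1 from a multiple of p^2 = 4, whose cofactor is (q + 1) / 4 rounded
     down. *)
  by apply: le_trans (F_lower (q.+1 %/ 4)%N n); rewrite p2; move: odd_q; clear; lia.
by exists n; lia.
Qed.

End PQTFactor.

(** * The exceptional product for q = 2 *)

Lemma Phi_2E : 'Phi_2 = 'X + 1 :> {poly int}.
Proof.
rewrite (Phi_p_geom 2 3) // geom1E !big_ord_recl big_ord0 expr0 expr1.
by rewrite /= addr0 addrC.
Qed.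

(* For q = 2 the coefficient of X^n, n = p k + r with r < p, is 2 R_k if r > 0,
   and R_k + R_(k-1), which vanishes unless k is 0 or p, if r = 0. *)
Lemma exceptional_coef_set p : prime p -> p <> 2%N ->
  coef_set (('X + 1) * 'Phi_p * 'Phi_(p ^ 2 * 2)) =i [:: -2; 0; 1; 2 : int].
Proof.
move=> pp p2; have p3 : (2 < p)%N by have := prime_gt1 pp; lia.
have p0 : (0 < p)%N by lia.
set F := _ * _ * _.
have R2 : ('X + 1) * 'Phi_(p * 2) = 'X^p + 1.
  rewrite -Phi_2E QR_geom // /geom poly_def !big_ord_recl big_ord0 /= !scale1r expr0 expr1.
  by rewrite comp_polyD comp_polyD comp_polyX comp_poly0 comp_polyC addr0 addrC.
set R := 'Phi_(p * 2) in R2 *.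
have R_rec k : R`_k.+1 + R`_k = (k.+1 == p)%:R.
  by have := congr1 (fun f : {poly int} => f`_k.+1) R2;
    rewrite mulrDl mul1r !coefD coefXM coefXn coef1 /= addr0 addrC.
have R0 : R`_0 = 1.
  by have := congr1 (fun f : {poly int} => f`_0) R2;
    rewrite mulrDl mul1r !coefD coefXM coefXn coef1 /= (ltn_eqF p0) !add0r.
have F_coef n : F`_n = (if (n == 0)%N then 0 else R`_(n.-1 %/ p)) + R`_(n %/ p).
  have Bn k : ('Phi_p * 'Phi_(p ^ 2 * 2))`_k = R`_(k %/ p).
    rewrite T_comp // coef_mul_comp_Xn ?(size_Phi_p p 2) // (Phi_p_geom p 2) //.
    by rewrite coef_geom // dvd1n muln1 ltn_pmod // mul1r.
  by rewrite /F -mulrA mulrDl mul1r coefD coefXM !Bn.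
have val n : F`_n \in [:: -2; 0; 1; 2 : int].
  rewrite F_coef; have [-> | n0] := eqVneq n 0%N; first by rewrite div0n R0.
  have fR := flat_R p 2 pp isT p2 (n %/ p)%N; rewrite -/R in fR.
  have [dv|ndv] := boolP (p %| n)%N; last first.
    suff -> : (n.-1 %/ p = n %/ p)%N.
      by move: (R`_(n %/ p)) fR => x fx; rewrite !inE; clear -fx; lia.
    case: n n0 ndv {fR} => // n _; rewrite /dvdn => nd /=.
    by rewrite divnS // /dvdn (negbTE nd) add0n.
  case: n n0 dv {fR} => // n _ dv; rewrite /= divnS // dv add1n addrC R_rec.
  by case: eqP.
have mem n : F`_n != 0 -> (n < size F)%N.
  by apply: contra_neqT; rewrite -leqNgt => le; rewrite nth_default.
have F1 : F`_1 = 2 by rewrite F_coef /= div0n divn_small ?R0 //; lia.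
have Fp : F`_p = 0.
  by rewrite F_coef (gtn_eqF p0) divnn p0 divn_small ?prednK // addrC R_rec (ltn_eqF (prime_gt1 pp)).
have Fp1 : F`_p.+1 = - 2.
  rewrite F_coef /= divnn p0 -addn1 divnDl ?dvdnn // divnn p0.
  rewrite (divn_small (_ : 1 < p)%N) ?addn0; last lia.
  by have := R_rec 0%N; rewrite R0 (ltn_eqF (prime_gt1 pp)) /=; lia.
have F0 : F`_0 = 1 by rewrite F_coef /= div0n R0.
have szF : (p.+1 < size F)%N by apply: mem; rewrite Fp1.
move=> c; apply/idP/idP => [/in_coef_set[n _ <-]|]; first exact: val.
rewrite !in_cons in_nil orbF => /or4P[] /eqP ->; apply/in_coef_set.
- by exists p.+1.
- by exists p => //; apply: ltnW.
- by exists 0%N => //; apply: leq_ltn_trans szF.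
by exists 1%N => //; apply: leq_ltn_trans szF; lia.
Qed.

Lemma exceptional_not_convex p : prime p -> p <> 2%N ->
  ~ coef_convex (('X + 1) * 'Phi_p * 'Phi_(p ^ 2 * 2)).
Proof.
move=> pp p2 [a [b [leab ab]]]; have E := exceptional_coef_set p pp p2.
(* The value -1 is missing between -2 and 1. *)
have := ab (- 2); have := ab 1; have := ab (- 1).
rewrite ![_ \in coef_set0 _]inE !E !inE /=; lia.
Qed.

(** * Convexity of all products *)

Section Convexity.

Variables p q : nat.
Hypotheses (hp : prime p) (hq : prime q) (hpq : p <> q).

Let p0 : (0 < p)%N := prime_gt0 hp.
Let q0 : (0 < q)%N := prime_gt0 hq.
Let p1 : (1 < p)%N := prime_gt1 hp.

Local Notation A := ('Phi_1).
Local Notation P := ('Phi_p).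
Local Notation Q := ('Phi_q).
Local Notation R := ('Phi_(p * q)).
Local Notation S := ('Phi_(p ^ 2)).
Local Notation T := ('Phi_(p ^ 2 * q)).

Let eA : A = 'X^1 - 1.
Proof. by have [] := Phi_identities p q hp hq hpq. Qed.
Let eAP : A * P = 'X^p - 1.
Proof. by have [] := Phi_identities p q hp hq hpq. Qed.
Let eAQ : A * Q = 'X^q - 1.
Proof. by have [] := Phi_identities p q hp hq hpq. Qed.
Let eAPQR : A * P * Q * R = 'X^(p * q) - 1.
Proof. by have [_ _ _ []] := Phi_identities p q hp hq hpq. Qed.
Let eAPS : A * P * S = 'X^(p ^ 2) - 1.
Proof. by have [_ _ _ []] := Phi_identities p q hp hq hpq. Qed.
(** Covers the 32 products without A. Flatness mostly comes from an expression as [geom], from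
    copies that do not overlap, from a quotient for a coprime pair, or from X^m - 1 times a
    polynomial with coefficients 0 and 1. *)
Lemma flat_table (b c d e k : bool) (g : {poly int}) :
  g = P ^+ b * Q ^+ c * R ^+ d * S ^+ e * T ^+ k ->
  [\/ flat g, flat (A * g) | [\/ g = R * S, g = Q * R * S | g = P * Q * T]].
Proof.
have g01 m n : (0 < m)%N -> flat (geom m n) by move=> m0; apply/zero_one_flat/zero_one_geom.
have f1 : flat 1 by move=> i; rewrite coef1; case: eqP.
have fP : flat P by apply/zero_one_flat/(zero_one_P p q).
have fQ : flat Q by apply/zero_one_flat/(zero_one_Q p q).
have fR : flat R by exact: flat_R.
have fPR : flat (P * R) by rewrite PR_geom //; apply: g01.
have fQR : flat (Q * R) by rewrite QR_geom //; apply: g01.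
have fPQR : flat (P * Q * R) by rewrite PQR_geom //; apply: g01.
have fS : flat S by apply/zero_one_flat/(zero_one_S p q).
have fPS : flat (P * S) by rewrite (PS_geom p q) //; apply: g01.
have fPRS : flat (P * R * S) by apply/zero_one_flat/zero_one_PRS.
have fT : flat T by exact: flat_T.
have fPT : flat (P * T) by exact: flat_PT.
have fRT : flat (R * T) by exact: flat_RT.
have fPRT : flat (P * R * T) by exact: flat_PRT.
have fQRT : flat (Q * R * T) by rewrite QRT_geom //; apply: g01; rewrite expn_gt0 p0.
have fPQRT : flat (P * Q * R * T) by apply/zero_one_flat/zero_one_PQRT.
have fST : flat (S * T) by apply/zero_one_flat/zero_one_ST.
have fPST : flat (P * S * T) by apply/zero_one_flat/zero_one_PST.
have fQST : flat (Q * S * T) by apply/zero_one_flat/zero_one_QST.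
have fRST : flat (R * S * T) by exact: flat_RST.
have fPRST : flat (P * R * S * T) by rewrite PRST_geom //; apply: g01.
have fQRST : flat (Q * R * S * T) by rewrite QRST_geom //; apply: g01.
have fPQRST : flat (P * Q * R * S * T) by rewrite PQRST_geom //; apply: g01.
have fAPQ : flat (A * (P * Q)).
  by rewrite mulrA eAP; apply/zero_one_flat_step/(zero_one_Q p q).
have fAQS : flat (A * (Q * S)).
  by rewrite mulrA eAQ; apply/zero_one_flat_step/(zero_one_S p q).
have fAPQS : flat (A * (P * Q * S)).
  rewrite mulrA mulrA mulrAC eAPS; exact/zero_one_flat_step/(zero_one_Q p q).
have fAPQRS : flat (A * (P * Q * R * S)).
  by rewrite !mulrA eAPQR; apply/zero_one_flat_step/(zero_one_S p q).
have fAQT : flat (A * (Q * T)) by rewrite mulrA; exact: flat_AQT.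
have fAPQST : flat (A * (P * Q * S * T)).
  rewrite -!mulrA mulrA eAP; apply: zero_one_flat_step; rewrite !mulrA; exact: zero_one_QST.
by move=> ->; case: b; case: c; case: d; case: e; case: k;
  rewrite ?expr0 ?expr1 ?mulr1 ?mul1r;
  first [constructor 1; assumption | constructor 2; assumption | constructor 3;
    first [by constructor 1 | by constructor 2 | by constructor 3]].
Qed.

Lemma RS_convex : coef_convex (R * S).
Proof.
apply: (flat_step_convex p) => //; rewrite -eAP.
have -> : A * P * (R * S) = ('X^1 - 1) * (P * R * S) by rewrite -eA; ring.
exact/zero_one_flat_step/zero_one_PRS.
Qed.

Lemma QRS_convex : coef_convex (Q * R * S).
Proof.
apply: (flat_step_convex p) => //; rewrite -eAP !mulrA eAPQR.
exact/zero_one_flat_step/(zero_one_S p q).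
Qed.

(** Both X^(p q) - 1 and S are polynomials in X^p with a flat product, and A has degree 1 < p, so
    that its copies do not overlap. *)
Lemma AQRS_convex : coef_convex (A * (Q * R * S)).
Proof.
apply: (flat_step_convex p) => //; rewrite -eAP.
have -> : A * P * (A * (Q * R * S)) = A * ((('X^q - 1) * geom 1 p) \Po 'X^p).
  rewrite comp_polyM comp_polyB comp_Xn_poly comp_polyC polyC1 -exprM geom_comp mul1n.
  by rewrite -(S_geom p q) // -eAPQR; ring.
apply: flat_spread; rewrite ?size_A //; first exact: (flat_A p q).
by apply/zero_one_flat_step/zero_one_geom.
Qed.

Lemma A_mul_coef_bound (g : {poly int}) n : flat g -> -2 <= (A * g)`_n <= 2.
Proof.
by move=> fg; rewrite eA coefXnsub1M; have := fg n; have := fg (n - 1)%N; case: ifP; lia.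
Qed.

Lemma A_mul_anti_reciprocal b c d e k :
  self_reciprocal (- 1) (A * (P ^+ nat_of_bool b * Q ^+ nat_of_bool c * R ^+ nat_of_bool d *
     S ^+ nat_of_bool e * T ^+ nat_of_bool k)).
Proof.
have [sP sQ sR sS sT] := self_reciprocal_factors p q hp hq hpq.
have sX n (x : bool) : self_reciprocal 1 'Phi_n -> self_reciprocal 1 ('Phi_n ^+ x).
  case: x; rewrite ?expr1 ?expr0 // => _.
  rewrite /self_reciprocal size_poly1; apply/polyP => i.
  by rewrite coef_poly scale1r !coef1; case: i.
have sM (f g : {poly int}) : f != 0 -> g != 0 -> self_reciprocal 1 f ->
    self_reciprocal 1 g -> self_reciprocal 1 (f * g).
  by move=> f0 g0 sf sg; rewrite -[1]mulr1; apply: self_reciprocalM.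
have nz n m : 'Phi_n ^+ m != 0 by rewrite expf_neq0 ?Phi_neq0.
rewrite -[- 1]mulr1; apply: self_reciprocalM; rewrite ?mulf_neq0 ?Phi_neq0 //.
  exact: (self_reciprocal_A p q).
by do 4!(apply: (sM); rewrite ?mulf_neq0 //; try exact: sX).
Qed.

Lemma Phi_product_convex (a b c d e k : bool) (f : {poly int}) :
  f = A ^+ a * (P ^+ b * Q ^+ c * R ^+ d * S ^+ e * T ^+ k) ->
  ~ (q = 2%N /\ f = P * Q * T) -> coef_convex f.
Proof.
set g := _ * T ^+ k => fE exc; have anti := A_mul_anti_reciprocal b c d e k.
rewrite -/g in anti; have gm : A * g \is monic by rewrite !monicMl ?monic_exp ?Cyclotomic_monic.
have [fg|fAg|spec] := flat_table b c d e k g erefl.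
- case: a fE => ->; rewrite ?expr1 ?expr0 ?mul1r; last exact: flat_convex.
  by apply: anti_reciprocal_convex => // n; apply: A_mul_coef_bound.
- case: a fE => ->; rewrite ?expr1 ?expr0 ?mul1r; first exact: flat_convex.
  by apply: (flat_step_convex 1) => //; rewrite -eA.
move: fE anti gm; case: spec => ->; case: a => /= fE anti gm; rewrite fE ?expr1 ?expr0 ?mul1r.
- by rewrite mulrA; apply: ARS_convex.
- exact: RS_convex.
- exact: AQRS_convex.
- exact: QRS_convex.
- apply: anti_reciprocal_convex => // n.
  (* P T is flat and A Q = X^q - 1 has two terms, which bounds the coefficients by 2. *)
  have -> : A * (P * Q * T) = A * Q * (P * T) by ring.
  rewrite eAQ coefXnsub1M.
  have fPT := flat_PT p q hp hq hpq; have := fPT n; have := fPT (n - q)%N.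
  by case: ifP; lia.
apply: PQT_convex => // q2; apply: exc; split=> //.
by rewrite fE expr0 mul1r.
Qed.

End Convexity.

(** * Strong convexity *)

(** Order 4 keeps the coefficient of X^3, which vanishes for 1, A and A^2, and drops X^p and X^q for
    p, q > 3. *)
Definition eq_mod_X4 (f g : {poly int}) := exists h, f = g + 'X^4 * h.

Lemma eq_mod_X4_coef (f g : {poly int}) i : eq_mod_X4 f g -> (i < 4)%N -> f`_i = g`_i.
Proof. by move=> [h ->] lti; rewrite coefD coefXnM lti addr0. Qed.

Lemma eq_mod_X4_refl f : eq_mod_X4 f f.
Proof. by exists 0; rewrite mulr0 addr0. Qed.

Lemma eq_mod_X4M (f f' g g' : {poly int}) :
  eq_mod_X4 f f' -> eq_mod_X4 g g' -> eq_mod_X4 (f * g) (f' * g').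
Proof. by move=> [h ->] [k ->]; exists (f' * k + h * g' + 'X^4 * h * k); ring. Qed.

Lemma eq_mod_X4_cancelN (u f g : {poly int}) :
  eq_mod_X4 u (- 1) -> eq_mod_X4 (u * f) (- g) -> eq_mod_X4 f g.
Proof.
move=> [h ->] [k e]; exists (h * f - k).
rewrite [LHS](_ : f = - ((- 1 + 'X^4 * h) * f) + 'X^4 * h * f); last by ring.
by rewrite e; ring.
Qed.

Lemma eq_mod_X4_Xnsub1 n : (4 <= n)%N -> eq_mod_X4 ('X^n - 1) (- 1).
Proof. by move=> le4n; exists 'X^(n - 4); rewrite -exprD subnKC // addrC. Qed.

(** The exponents 0, m, n and m + n are distinct. *)
Lemma flat_Xnsub1M m n : (0 < m)%N -> (0 < n)%N -> m <> n ->
  flat (('X^m - 1) * ('X^n - 1)).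
Proof.
move=> m0 n0 mn i; rewrite coefXnsub1M !coefB !coefXn !coef1.
by case: ltnP => lim; lia.
Qed.

Section StrongConvexity.

Variables p q : nat.
Hypotheses (hp : prime p) (hq : prime q) (hpq : p <> q).
Hypotheses (p5 : (4 < p)%N) (q5 : (4 < q)%N).

Let p0 : (0 < p)%N := prime_gt0 hp.
Let q0 : (0 < q)%N := prime_gt0 hq.

Local Notation A := ('Phi_1).
Local Notation P := ('Phi_p).
Local Notation Q := ('Phi_q).
Local Notation R := ('Phi_(p * q)).
Local Notation S := ('Phi_(p ^ 2)).
Local Notation T := ('Phi_(p ^ 2 * q)).

Let eA : A = 'X^1 - 1.
Proof. by have [] := Phi_identities p q hp hq hpq. Qed.
Let eAP : A * P = 'X^p - 1.
Proof. by have [] := Phi_identities p q hp hq hpq. Qed.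
Let eAQ : A * Q = 'X^q - 1.
Proof. by have [] := Phi_identities p q hp hq hpq. Qed.
Let eAPQR : A * P * Q * R = 'X^(p * q) - 1.
Proof. by have [_ _ _ []] := Phi_identities p q hp hq hpq. Qed.
Let eAPS : A * P * S = 'X^(p ^ 2) - 1.
Proof. by have [_ _ _ []] := Phi_identities p q hp hq hpq. Qed.
Let eall : A * P * Q * R * S * T = 'X^(p ^ 2 * q) - 1.
Proof. by have [_ _ _ []] := Phi_identities p q hp hq hpq. Qed.

Let pq4 : (4 <= p * q)%N.
Proof. by rewrite (leq_trans (ltnW p5)) // leq_pmulr. Qed.
Let pp4 : (4 <= p ^ 2)%N.
Proof. by rewrite -mulnn (leq_trans (ltnW p5)) // leq_pmulr. Qed.

Let lAP : eq_mod_X4 (A * P) (- 1).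
Proof. by rewrite eAP; apply: eq_mod_X4_Xnsub1; apply: ltnW. Qed.
Let lAQ : eq_mod_X4 (A * Q) (- 1).
Proof. by rewrite eAQ; apply: eq_mod_X4_Xnsub1; apply: ltnW. Qed.
Let lAPQR : eq_mod_X4 (A * P * Q * R) (- 1).
Proof. by rewrite eAPQR; apply: eq_mod_X4_Xnsub1. Qed.
Let lS : eq_mod_X4 S 1.
Proof. by apply: eq_mod_X4_cancelN lAP _; rewrite eAPS; apply: eq_mod_X4_Xnsub1. Qed.
Let lT : eq_mod_X4 T 1.
Proof.
have l : eq_mod_X4 (A * P * Q * R * S) (- 1) by rewrite -[- 1]mulr1; apply: eq_mod_X4M.
apply: eq_mod_X4_cancelN l _; rewrite eall; apply: eq_mod_X4_Xnsub1.
by rewrite (leq_trans pp4) // leq_pmulr.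
Qed.
Let lPR : eq_mod_X4 (P * R) 1.
Proof.
apply: eq_mod_X4_cancelN lAQ _; rewrite (_ : _ * _ = A * P * Q * R) //; ring.
Qed.
Let lQR : eq_mod_X4 (Q * R) 1.
Proof. by apply: eq_mod_X4_cancelN lAP _; rewrite mulrA. Qed.
Let lR : eq_mod_X4 R (- A).
Proof.
apply: eq_mod_X4_cancelN lAP _; rewrite opprK -mulrA -[X in eq_mod_X4 _ X]mulr1.
exact/eq_mod_X4M/lPR/eq_mod_X4_refl.
Qed.

Let A_coef n : (1 < n)%N -> A`_n = 0.
Proof. by move=> n1; rewrite nth_default ?size_A. Qed.

Lemma R_low_coef n : (1 < n < 4)%N -> R`_n = 0.
Proof. by case/andP=> n1 n4; rewrite (eq_mod_X4_coef _ _ n lR) // coefN A_coef ?oppr0. Qed.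

(* Modulo X^4 the factors P and Q are congruent to - A^-1, R to - A, and S and T to 1; a nonnegative
   power A^m with m <= 2 has no term in X^3. *)
Lemma coef3_eq0 (a b c d e k : bool) : (b + c <= a + d)%N ->
  (A ^+ a * (P ^+ b * Q ^+ c * R ^+ d * S ^+ e * T ^+ k))`_3 = 0.
Proof.
move=> le; have lX (g : {poly int}) (x : bool) : eq_mod_X4 g 1 -> eq_mod_X4 (g ^+ x) 1.
  by case: x => //; rewrite expr0 => _; apply: eq_mod_X4_refl.
have lAR : eq_mod_X4 (A * R) (- (A * A)).
  by rewrite -mulrN; apply: eq_mod_X4M lR; apply: eq_mod_X4_refl.
have lAPR : eq_mod_X4 (A * (P * R)) A.
  by rewrite -[X in eq_mod_X4 _ X]mulr1; apply: eq_mod_X4M lPR; apply: eq_mod_X4_refl.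
have lAQR : eq_mod_X4 (A * (Q * R)) A.
  by rewrite -[X in eq_mod_X4 _ X]mulr1; apply: eq_mod_X4M lQR; apply: eq_mod_X4_refl.
have lAPQR' : eq_mod_X4 (A * (P * Q * R)) (- 1) by rewrite !mulrA.
have AA3 : (A * A)`_3 = 0.
  by rewrite [in X in X * _]eA coefXnsub1M /= subn1 !A_coef ?subr0.
suff [v [lv v3]] : exists v, eq_mod_X4 (A ^+ a * (P ^+ b * Q ^+ c * R ^+ d)) v /\ v`_3 = 0.
  have -> : A ^+ a * (P ^+ b * Q ^+ c * R ^+ d * S ^+ e * T ^+ k) =
      A ^+ a * (P ^+ b * Q ^+ c * R ^+ d) * (S ^+ e * T ^+ k) by rewrite !mulrA.
  rewrite (eq_mod_X4_coef _ v) // -[v]mulr1 -[1]mulr1.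
  by apply: eq_mod_X4M lv _; apply: eq_mod_X4M; apply: lX.
have one3 : (1 : {poly int})`_3 = 0 by rewrite coef1.
case: a b c d le => [] [] [] [] //= _; rewrite ?expr0 ?expr1 ?mulr1 ?mul1r.
all: first
  [ by exists 1; split; [exact: eq_mod_X4_refl || assumption | exact: one3]
  | by exists A; split; [exact: eq_mod_X4_refl || assumption | exact: A_coef]
  | by exists (- 1); split; [assumption | rewrite coefN one3 oppr0]
  | by exists (- A); split; [assumption | rewrite coefN A_coef ?oppr0]
  | by exists (- (A * A)); split; [assumption | rewrite coefN AA3 oppr0] ].
Qed.

(** These products are, up to sign, congruent to a negative power of A modulo X^4. For most of them
    A f is X^n - 1 times a polynomial with coefficients 0 and 1, or has two distinct binomials as
    factors. *)
Lemma flat_step_table (a b c d e k : bool) (f : {poly int}) : (a + d < b + c)%N ->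
  f = A ^+ a * (P ^+ b * Q ^+ c * R ^+ d * S ^+ e * T ^+ k) ->
  flat (A * f) \/ [\/ f = P * T, f = P * Q * T | f = A * (P * Q * T)].
Proof.
have bin g n : zero_one g -> flat (('X^n - 1) * g) by exact: zero_one_flat_step.
have gP (h : {poly int}) n g : A * h = ('X^n - 1) * g -> zero_one g -> flat (A * h).
  by move=> ->; apply: bin.
have one : zero_one 1 by move=> i; rewrite coef1; case: eqP.
have b1 : flat (A * P) by apply: (gP _ p 1) => //; rewrite mulr1.
have b2 : flat (A * (P * S)) by apply: (gP _ (p ^ 2)%N 1) => //; rewrite mulr1 mulrA.
have zS := zero_one_S p q hp hq hpq; have zQ := zero_one_Q p q hp hq hpq.
have zST := zero_one_ST p q hp hq hpq; have zQST := zero_one_QST p q hp hq hpq.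
have b3 : flat (A * (P * S * T)).
  by apply: (gP _ p (S * T)) => //; rewrite -eAP; ring.
have b4 : flat (A * Q) by apply: (gP _ q 1) => //; rewrite mulr1.
have b5 : flat (A * (Q * S)) by apply: (gP _ q S) => //; rewrite -eAQ; ring.
have b6 : flat (A * (Q * T)) by rewrite mulrA; apply: flat_AQT.
have b7 : flat (A * (Q * S * T)) by apply: (gP _ q (S * T)) => //; rewrite -eAQ; ring.
have b8 : flat (A * (P * Q)) by apply: (gP _ p Q) => //; rewrite -eAP; ring.
have b9 : flat (A * (P * Q * S)) by apply: (gP _ (p ^ 2)%N Q) => //; rewrite -eAPS; ring.
have b10 : flat (A * (P * Q * S * T)).
  by apply: (gP _ p (Q * S * T)) => //; rewrite -eAP; ring.
have b11 : flat (A * (P * Q * R)).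
  by apply: (gP _ (p * q)%N 1) => //; rewrite -eAPQR; ring.
have b12 : flat (A * (P * Q * R * S)).
  by apply: (gP _ (p * q)%N S) => //; rewrite -eAPQR; ring.
have b13 : flat (A * (P * Q * R * T)).
  apply: (gP _ p (Q * R * T)); first by rewrite -eAP; ring.
  by rewrite QRT_geom //; apply: zero_one_geom; rewrite expn_gt0 p0.
have b14 : flat (A * (P * Q * R * S * T)).
  by apply: (gP _ (p ^ 2 * q)%N 1) => //; rewrite -eall; ring.
have b15 : flat (A * (A * (P * Q))).
  rewrite (_ : _ * _ = ('X^p - 1) * ('X^q - 1)); last by rewrite -eAP -eAQ; ring.
  exact: flat_Xnsub1M.
have b16 : flat (A * (A * (P * Q * S))).
  rewrite (_ : _ * _ = ('X^(p ^ 2) - 1) * ('X^q - 1)); last by rewrite -eAPS -eAQ; ring.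
  apply: flat_Xnsub1M; rewrite ?expn_gt0 ?p0 //.
  by move=> ppq; move: hq; rewrite -ppq -mulnn => /primeP[_ /(_ p (dvdn_mulr _ (dvdnn p)))]; nia.
have b17 : flat (A * (A * (P * Q * S * T))).
  rewrite (_ : _ * _ = ('X^p - 1) * ('X^q - 1) * (geom 1 p \Po 'X^(p * q))); last first.
    by rewrite -ST_comp // -eAP -eAQ; ring.
  apply: flat_spread; rewrite ?muln_gt0 ?p0 //; last exact/zero_one_flat/zero_one_geom.
    rewrite (leq_trans (size_polyMleq _ _)) // !size_XnsubC //.
    by move: p5 q5; clear; nia.
  exact: flat_Xnsub1M.
by move=> le ->; case: a b c d e k le => [] [] [] [] [] [] //= _;
  rewrite ?expr0 ?expr1 ?mulr1 ?mul1r;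
  first [by left | right; first [by constructor 1 | by constructor 2 | by constructor 3]].
Qed.

(** The zeros exhibited below for multiples of T lie at places up to 2p + q, hence within the
    degree. *)
Let size_T : (p.*2 + q < size T)%N.
Proof.
rewrite size_Cyclotomic totient_coprime ?coprime_expl_prime // totient_pfactor // totient_prime //.
by rewrite expn1; move: p5 q5; clear; nia.
Qed.

Lemma PT_coef n : (P * T)`_n = R`_(n %/ p).
Proof.
rewrite T_comp // coef_mul_comp_Xn ?(size_Phi_p p q) // (Phi_p_geom p q) //.
by rewrite coef_geom // dvd1n muln1 ltn_pmod // mul1r.
Qed.

Let size_mulT (f : {poly int}) : f != 0 -> (p.*2 + q < size (f * T)%R)%N.
Proof.
move=> f0; apply: leq_trans size_T _; apply: dvdp_leq; last exact: dvdp_mulIr.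
by rewrite mulf_neq0 ?Phi_neq0.
Qed.

(** The coefficient at 2p is R_2, and R is congruent to 1 - X modulo X^4. *)
Lemma PT_zero : exists2 i, (i < size (P * T)%R)%N & (P * T)`_i = 0.
Proof.
exists p.*2; first by rewrite (leq_ltn_trans (leq_addr q _)) // size_mulT ?Phi_neq0.
by rewrite PT_coef -muln2 mulKn // R_low_coef.
Qed.

(** The first zero 2p - 1 of W serves if it lies below q; otherwise both terms vanish at q + 2p - 1
    < 4p < p^2. *)
Lemma PQT_has_zero : exists2 i, (i < size (P * Q * T)%R)%N & (P * Q * T)`_i = 0.
Proof.
have sz := size_mulT (P * Q) (mulf_neq0 (Phi_neq0 _) (Phi_neq0 _)).
have pp5 : (4 * p < p ^ 2)%N by rewrite -mulnn ltn_pmul2r.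
have pq5 : (4 * p < p * q)%N by rewrite mulnC ltn_pmul2l.
have [le|lt] := leqP p.*2 q.
  exists p.*2.-1; first by lia.
  by apply: PQT_zero; rewrite // ?modn_small //; lia.
exists (q + p.*2.-1)%N; first by lia.
by apply: PQT_zero => //; [lia | rewrite modn_small; lia | rewrite addKn eqxx implybT].
Qed.

(** With A Q = X^q - 1 the coefficients are differences of coefficients of P T, which are those of R
    at indices divided by p. The chosen places only read R_2 and R_3, since q / p < 2 in the second
    case. *)
Lemma APQT_has_zero :
  exists2 i, (i < size (A * (P * Q * T))%R)%N & (A * (P * Q * T))`_i = 0.
Proof.
have -> : A * (P * Q * T) = A * P * Q * T by ring.
have sz := size_mulT (A * P * Q) (mulf_neq0 (mulf_neq0 (Phi_neq0 _) (Phi_neq0 _)) (Phi_neq0 _)).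
have eF : A * P * Q * T = ('X^q - 1) * (P * T) by rewrite -eAQ; ring.
have B2 : (P * T)`_(p.*2) = 0 by rewrite PT_coef -muln2 mulKn // R_low_coef.
have nq : q <> p.*2.
  by move=> qE; have := coprime_pq p q hp hq hpq; rewrite prime_coprime // qE -muln2 dvdn_mulr.
have [le|lt] := ltnP p.*2 q.
  exists p.*2; first by lia.
  by rewrite eF coefXnsub1M le B2.
exists (p.*2 + q)%N; first by lia.
rewrite eF coefXnsub1M ltnNge leq_addl addnK B2 /= PT_coef -muln2 (mulnC p 2) divnMDl //.
have ltqp : (q %/ p < 2)%N by rewrite ltn_divLR //; lia.
by rewrite R_low_coef ?subrr // !ltnS; move: ltqp; case: (q %/ p)%N => [|[]].
Qed.

Lemma Phi_product_strongly_convex (a b c d e k : bool) (f : {poly int}) :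
  f = A ^+ a * (P ^+ b * Q ^+ c * R ^+ d * S ^+ e * T ^+ k) ->
  f <> A -> strongly_coef_convex f.
Proof.
move=> fE fA; have f0 : f != 0 by rewrite fE !mulf_neq0 ?expf_neq0 ?Phi_neq0.
have cf : coef_convex f.
  by apply: (Phi_product_convex p q hp hq hpq a b c d e k) => // -[q2]; lia.
have [lt|le] := ltnP (a + d) (b + c).
  have [fl|[] fs] := flat_step_table a b c d e k f lt fE.
  - by apply: flat_step_strongly_convex; rewrite // -Phi1E.
  - have [i lti i0] := PT_zero; rewrite fs in cf *; exact: convex_strongly_convex cf lti i0.
  - have [i lti i0] := PQT_has_zero; rewrite fs in cf *; exact: convex_strongly_convex cf lti i0.
  have [i lti i0] := APQT_has_zero; rewrite fs in cf *; exact: convex_strongly_convex cf lti i0.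
have [triv|] := boolP [|| b, c, d, e | k]; last first.
  move: fE fA; case: b c d e k {le} => [] [] [] [] [] //=; rewrite !expr0 !mulr1.
  case: a => ->; rewrite ?expr1 ?expr0 // => _ _.
  apply: flat_step_strongly_convex; first exact: oner_neq0.
  by rewrite mulr1 -Phi1E; apply: (flat_A p q).
apply: (convex_strongly_convex f 3 cf); last by rewrite fE coef3_eq0.
(* The zero at X^3 counts only if deg f >= 3, which any single factor other than A ensures. *)
have big n : (2 < totient n)%N -> 'Phi_n %| f -> (3 < size f)%N.
  by move=> t3 dv; apply: leq_trans (dvdp_leq f0 dv); rewrite size_Cyclotomic.
have t1 m n : (4 < m)%N -> (4 < n)%N -> (2 < m.-1 * n.-1)%N by clear; nia.
case/or4P: triv => [tb|tc|td|/orP[te|tk]].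
- apply: (big p); first by rewrite totient_prime //; lia.
  by rewrite fE tb expr1 dvdp_mull // -!mulrA dvdp_mulr.
- apply: (big q); first by rewrite totient_prime //; lia.
  by rewrite fE tc expr1 dvdp_mull // -!mulrA dvdp_mull // dvdp_mulr.
- apply: (big (p * q)%N); first by rewrite totient_coprime ?coprime_pq // !totient_prime // t1.
  by rewrite fE td expr1 -!mulrA; do 3!apply: dvdp_mull; apply: dvdp_mulr.
- apply: (big (p ^ 2)%N); first by rewrite totient_pfactor //; move: p5; clear; nia.
  by rewrite fE te expr1 -!mulrA; do 4!apply: dvdp_mull; apply: dvdp_mulr.
apply: (big (p ^ 2 * q)%N); last by rewrite fE tk expr1 dvdp_mull // dvdp_mull.
by have := size_T; rewrite size_Cyclotomic; lia.
Qed.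

End StrongConvexity.

(** * The exception X - 1 and the proof of the theorem *)

Lemma X_sub1_not_strongly_convex : ~ strongly_coef_convex ('X - 1).
Proof.
move=> [a [b [leab ab]]].
have c i : ('X - 1 : {poly int})`_i = (i == 1)%N%:R - (i == 0)%N%:R.
  by rewrite coefB coefX coef1.
have mem x : (x \in coef_set ('X - 1)) -> x = 1 \/ x = - 1.
  case/in_coef_set=> i; rewrite size_XsubC c => lti <-.
  by case: i lti => [|[|i]] // _; [right | left].
have s (i : nat) : (i < 2)%N -> ('X - 1 : {poly int})`_i \in int_interval a b.
  by move=> lti; rewrite -ab; apply/in_coef_set; exists i => //; rewrite size_XsubC.
have := s 0%N isT; have := s 1%N isT; rewrite !c !inE /= => h1 h2.
(* The value 0 lies between the coefficients -1 and 1 without being one. *)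
have /mem : 0 \in coef_set ('X - 1) by rewrite ab inE; lia.
by case.
Qed.

Theorem theorem3 (p q : nat) (hp : prime p) (hq : prime q) (hpq : p <> q) :
  (forall f : {poly int},
      monic_divisor f ('X^(p ^ 2 * q) - 1) ->
      (coef_convex f <->
       ~ (q = 2%N /\ f = ('X + 1) * 'Phi_p * 'Phi_(2 * p ^ 2)))) /\
  (q = 2%N ->
      monic_divisor (('X + 1) * 'Phi_p * 'Phi_(2 * p ^ 2))
                    ('X^(p ^ 2 * q) - 1) /\
      coef_set (('X + 1) * 'Phi_p * 'Phi_(2 * p ^ 2))
        =i [:: -2; 0; 1; 2 : int]) /\
  ((3 < minn p q)%N ->
      forall f : {poly int},
        monic_divisor f ('X^(p ^ 2 * q) - 1) ->
        (strongly_coef_convex f <-> f <> 'X - 1)).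
Proof.
have Phi2 : 'Phi_2 = 'X + 1 :> {poly int} by exact: Phi_2E.
rewrite (mulnC 2); split=> [f|]; last split=> [q2|].
- case/(monic_divisor_cases p q hp hq hpq)=> [a [b [c [d [e [k fE]]]]]].
  split=> [cf [q2 fexc]|exc].
    by subst q; apply: (exceptional_not_convex p hp hpq); rewrite -fexc.
  apply: (Phi_product_convex p q hp hq hpq a b c d e k) => // -[q2 fPQT].
  by apply: exc; split=> //; rewrite fPQT q2 Phi2; congr (_ * _); rewrite mulrC.
- subst q; split; last exact: exceptional_coef_set.
  split; first by rewrite -Phi2 !monicMl ?Cyclotomic_monic.
  have [_ _ _ [_ _ <-]] := Phi_identities p 2 hp hq hpq.
  by exists ('Phi_1 * 'Phi_(p * 2) * 'Phi_(p ^ 2)); rewrite -Phi2; ring.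
move=> pq4 f; case/(monic_divisor_cases p q hp hq hpq)=> [a [b [c [d [e [k fE]]]]]].
split=> [sc fX|fX]; first by apply: X_sub1_not_strongly_convex; rewrite -fX.
have ge5 n : prime n -> (3 < n)%N -> (4 < n)%N.
  by move=> pn n3; rewrite ltn_neqAle n3 andbT; apply: contraTneq pn => <-.
apply: (Phi_product_strongly_convex p q hp hq hpq _ _ a b c d e k) => //.
- by apply: ge5 => //; lia.
- by apply: ge5 => //; lia.
by rewrite Phi1E.
Qed.
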